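(* Let $a$ and $b$ be continuous and $a>0$ on $(-M,N)$, and let $\mu,\nu,\lambda^{\mathrm{DD}},\lambda^{\mathrm{NN}}$ be associated with $L=a(x)\frac{d^2}{dx^2}+b(x)\frac{d}{dx}$, and $\underline\kappa^{\mathrm{DD}},\underline\kappa^{\mathrm{NN}}$ be defined, as in the context. If $\nu(-M,N)<\infty$, then $\lambda^{\mathrm{DD}}\ge(\underline\kappa^{\mathrm{DD}})^{-1}$. If $\mu(-M,N)<\infty$, then $\lambda^{\mathrm{NN}}\ge(\underline\kappa^{\mathrm{NN}})^{-1}$.
   Context: Let $M,N\in(0,\infty]$. Fix a reference point $x_0\in(-M,N)$ and put $C(x)=\int_{x_0}^x\frac ba\,du$, $\mu(dx)=\frac{e^{C(x)}}{a(x)}dx$, $\nu(dx)=e^{-C(x)}dx$. For an interval, $\mu(x,y)$ and $\nu(x,y)$ denote the measures of $(x,y)$. $\|\cdot\|$ is the norm of $L^2(\mu)$, $\mu(f)=\int f\,d\mu$, $D(f)=\int_{-M}^N(f')^2e^{C}dx$, $\mathcal A(-M,N)$ is the set of absolutely continuous functions on $(-M,N)$, and $\mathcal A_0(-M,N)$ is the subset of functions with compact support. Then $$\lambda^{\mathrm{DD}}=\inf\{D(f): f\in\mathcal A_0(-M,N),\ \|f\|=1\},$$ $$\lambda^{\mathrm{NN}}=\inf\{D(f): f\in\mathcal A(-M,N),\ \mu(f)=0,\ \|f\|=1\}.$$ Definition of $\underline\kappa^{\mathrm{DD}}$ (when $\nu(-M,N)<\infty$). For a positive continuous function $f$ on $(-M,N)$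 put $$h_f^-(z)=\int_{-M}^z\nu(dx)\int_x^{\theta}f\,d\mu\quad(z\le\theta),\qquad h_f^+(z)=\int_z^N\nu(dx)\int_{\theta}^xf\,d\mu\quad(z\ge\theta),$$ where $\theta=\theta(f)\in(-M,N)$ is the unique root of $h_f^-(\theta)=h_f^+(\theta)$ (provided $h_f^{\pm}<\infty$), and set $I\!I^{\pm}(f)=h_f^{\pm}/f$. For $-M<x<y<N$ define $$f^{x,y}(s)=\begin{cases}\sqrt{\dfrac{\nu(y,N)}{\nu(-M,x)}\,\nu(-M,\min\{s,x\})},& s\le y,\\[2mm] \sqrt{\nu(s,N)},& s\ge y,\end{cases}$$ and $$\underline\kappa^{\mathrm{DD}}=\inf_{x<y}\max\Big\{\sup_{z\in(-M,\theta)}I\!I^-(f^{x,y})(z),\ \sup_{z\in(\theta,N)}I\!I^+(f^{x,y})(z)\Big\},\qquad \theta=\theta(f^{x,y}).$$ If $h^-_{f^{x,y}}$ or $h^+_{f^{x,y}}$ is infinite, the maximum is read as $\infty$; $1/\infty=0$. Definition of $\underline\kappa^{\mathrm{NN}}$ (when $\mu(-M,N)<\infty$): the same as $\underline\kappa^{\mathrm{DD}}$ with $\mu$ and $\nu$ exchanged everywhere (in $h_f^\pm$, in $\theta(f)$ and in $f^{x,y}$). *)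

(* Defs.v *)
From HB Require Import structures.
From mathcomp Require Import all_boot all_order all_algebra.
From mathcomp Require Import all_classical all_reals all_analysis.

Set Implicit Arguments.
Unset Strict Implicit.
Unset Printing Implicit Defensive.

Import Order.TTheory GRing.Theory Num.Theory.
Import numFieldNormedType.Exports.

Local Open Scope classical_set_scope.
Local Open Scope ring_scope.

(* The open interval (l, r) of real numbers with extended-real endpoints. *)
Definition oitv (R : realType) (l r : \bar R) : set R :=
  [set x | (l < x%:E)%E /\ (x%:E < r)%E].

Section Diffusion.
Variables (R : realType) (M N : \bar R) (a b : R -> R) (x0 : R).

Let I : set R := oitv (- M)%E N.

(* Oriented integral from x0 to x. *)
Definition Cfun (x : R) : R :=
  if x0 <= x then \int[lebesgue_measure]_(u in `[x0, x]) (b u / a u)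
  else - \int[lebesgue_measure]_(u in `[x, x0]) (b u / a u).

(* [mu] and [nu] are carried by (-M, N): values of [a] and [b] outside this
   interval are irrelevant. *)
Definition mu (A : set (measurableTypeR R)) : \bar R :=
  (\int[lebesgue_measure]_(x in A `&` I) (expR (Cfun x) / a x)%:E)%E.

Definition nu (A : set (measurableTypeR R)) : \bar R :=
  (\int[lebesgue_measure]_(x in A `&` I) (expR (- Cfun x))%:E)%E.

Definition L2norm (f : R -> R) : \bar R :=
  ((\int[mu]_(x in I) (f x ^+ 2)%:E) `^ 2^-1)%E.

(* [derive1] is the library's total derivative (0 where the limit does not
   exist), an almost everywhere derivative when [f] is absolutely continuous. *)
Definition Dform (f : R -> R) : \bar R :=
  (\int[lebesgue_measure]_(x in I) (derive1 f x ^+ 2 * expR (Cfun x))%:E)%E.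

Definition abs_continuous_on (c d : R) (f : R -> R) : Prop :=
  forall e : R, 0 < e -> exists2 delta : R, 0 < delta &
    forall (n : nat) (l r : 'I_n -> R),
      (forall i, [/\ c <= l i, l i <= r i & r i <= d]) ->
      trivIset [set: 'I_n] (fun i => `]l i, r i[%classic) ->
      \sum_(i < n) (r i - l i) < delta ->
      \sum_(i < n) `|f (r i) - f (l i)| < e.

(* On the (possibly unbounded) open interval, absolute continuity is meant on
   every compact subinterval.  Values outside (-M, N) are irrelevant. *)
Definition locally_AC (f : R -> R) : Prop :=
  forall c d : R, I c -> I d -> abs_continuous_on c d f.

Definition locally_AC0 (f : R -> R) : Prop :=
  locally_AC f /\ exists K : set R,
    [/\ compact K, K `<=` I & forall x, I x -> ~ K x -> f x = 0].

Definition lambdaDD : \bar R :=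
  ereal_inf [set Dform f | f in [set f | locally_AC0 f /\ L2norm f = 1%E]].

Definition lambdaNN : \bar R :=
  ereal_inf [set Dform f | f in
    [set f | [/\ locally_AC f, (\int[mu]_(x in I) (f x)%:E = 0)%E
               & L2norm f = 1%E]]].

(* In what follows (m, n) stands for (mu, nu) in the DD case and for (nu, mu)
   in the NN case; [t] stands for the splitting point theta. *)
Section Kappa.
Variables m n : set (measurableTypeR R) -> \bar R.

Definition hminus (f : R -> R) (t z : R) : \bar R :=
  (\int[n]_(x in oitv (- M) z%:E) \int[m]_(u in `[x, t]) (f u)%:E)%E.

Definition hplus (f : R -> R) (t z : R) : \bar R :=
  (\int[n]_(x in oitv z%:E N) \int[m]_(u in `[t, x]) (f u)%:E)%E.

(* Independently of theta: when n(-M, N) is finite and f is positive and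
   continuous, finiteness of h^-_f and h^+_f does not depend on the splitting
   point. *)
Definition hfinite (f : R -> R) : Prop :=
  forall t, I t -> (hminus f t t < +oo)%E /\ (hplus f t t < +oo)%E.

(* The root is unique when [hfinite f], the only case where it is used. *)
Definition theta (f : R -> R) : R :=
  get [set t | I t /\ hminus f t t = hplus f t t].

Definition IIminus (f : R -> R) (z : R) : \bar R :=
  (hminus f (theta f) z / (f z)%:E)%E.

Definition IIplus (f : R -> R) (z : R) : \bar R :=
  (hplus f (theta f) z / (f z)%:E)%E.

Definition max_sup_II (f : R -> R) : \bar R :=
  if `[< hfinite f >] then
    maxe (ereal_sup [set IIminus f z | z in oitv (- M)%E (theta f)%:E])
         (ereal_sup [set IIplus f z | z in oitv (theta f)%:E N])
  else +oo%E.

Definition fxy (x y s : R) : R :=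
  if s <= y then
    Num.sqrt (fine (n (oitv y%:E N)) / fine (n (oitv (- M)%E x%:E))
              * fine (n (oitv (- M)%E (Num.min s x)%:E)))
  else Num.sqrt (fine (n (oitv s%:E N))).

Definition kappa : \bar R :=
  ereal_inf [set k | exists x y : R,
    [/\ I x, I y, x < y & k = max_sup_II (fxy x y)]].

End Kappa.

Definition kappaDD : \bar R := kappa mu nu.
Definition kappaNN : \bar R := kappa nu mu.

End Diffusion.

(* Main.v *)
Require Import Defs.
From HB Require Import structures.
From mathcomp Require Import all_boot all_order all_algebra.
From mathcomp Require Import all_classical all_reals all_analysis.
From mathcomp Require Import measurable_realfun.
From mathcomp Require Import ring lra.

Set Implicit Arguments.
Unset Strict Implicit.
Unset Printing Implicit Defensive.

Import Order.TTheory GRing.Theory Num.Theory.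
Import numFieldNormedType.Exports.
Import HBNNSimple.

Local Open Scope classical_set_scope.
Local Open Scope ring_scope.

(** Let [m] and [n] be the densities of the two measures in the order in which
    the constant uses them: [e^C / a] and [e^-C] in the Dirichlet case,
    exchanged in the Neumann case.  Let [f] be one of the test functions, [t]
    its splitting point, [p x] the oriented integral of [f m] from [t] to [x],
    and [h] the function [h^-] to the left of [t] and [h^+] to its right.  Then
    [p' = f m] and [h' = - p n], so [w = - p / h] satisfies
    [w' = - f m / h - n w^2].  A bound [h <= K f], which is what the supremum of
    [II] provides, turns this equation into the Riccati inequality
    [w' + n w^2 + m / K <= 0].  Completing a square, for every absolutely
    continuous [G],
      [G'^2 / n - (G^2 w)' - G^2 m / K >= (G' - n w G)^2 / n >= 0],
    and integration gives a weighted Hardy inequality with constant [K], up to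
    boundary terms ([riccati_energy_bound], [potential_energy_bound]).  The two
    halves of the interval fit together because [w] vanishes at [t].

    In the Dirichlet case this inequality, applied to a function with compact
    support, is the claim ([dirichlet_energy_bound]).

    In the Neumann case it is applied to [G x], the [mu]-integral of [g] over
    [(-M, x)].  Here [G'^2 / n = g^2 n], and the boundary term at [c] is at
    most the [mu]-integral of [g^2] over [(-M, c)]: the coefficient of [G c ^ 2]
    is at most the inverse of the mass of [(-M, c)], and the Cauchy-Schwarz
    inequality bounds [G c ^ 2].  Hence the integral of [G^2 m / K] is at most
    [1].  Now choose [c] and [d] near the ends with
    [g c G c >= 0 >= g d G d]; integrating [(g G)' = g' G + g^2 n] over
    [[c, d]] and using [- g' G <= G^2 m / (2 K) + K g'^2 / (2 m)] gives
    [1 <= 1 / 2 + K D(g) / 2] in the limit ([neumann_energy_bound]).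

    Both cases rest on the fundamental theorem of calculus for absolutely
    continuous functions ([ac_ftc]): such a function is a difference of
    nondecreasing ones, the Stieltjes measure of each of these is dominated by
    the Lebesgue measure, and the Radon-Nikodym density is the derivative almost
    everywhere by the Lebesgue differentiation theorem.  The energy is
    bounded from below only, and this makes sense for a derivative of unknown
    measurability because the integral of a nonnegative function is a supremum
    over simple functions ([ge0_le_integral_ae]). *)

(** * Total variation of an absolutely continuous function *)

(** Collecting the cells of several partitions yields families indexed by a
    dependent sum rather than by an initial segment of the integers. *)
Lemma ac_fintype (R : realType) (c d : R) (f : R -> R) (e : R) :
  abs_continuous_on c d f -> 0 < e -> exists2 delta : R, 0 < delta &
  forall (T : finType) (l r : T -> R),
    (forall i, [/\ c <= l i, l i <= r i & r i <= d]) ->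
    trivIset [set: T] (fun i => `]l i, r i[%classic) ->
    \sum_i (r i - l i) < delta -> \sum_i `|f (r i) - f (l i)| < e.
Proof.
move=> acf e0; have [delta delta0 acd] := acf _ e0; exists delta => // T l r lr tlr.
have := acd #|T| (l \o enum_val) (r \o enum_val).
have sumE (g : T -> R) : \sum_i g i = \sum_(j < #|T|) g (enum_val j).
  by rewrite (reindex (enum_val : 'I_#|T| -> T))//; exact/onW_bij/enum_val_bij.
rewrite !sumE => H1; apply: acd => //.
apply/trivIsetP => i j _ _ ij; move/trivIsetP : tlr; apply => //.
by apply: contra ij => /eqP /enum_val_inj ->.
Qed.
(** The cells of all the partitions form one family of disjoint intervals with
    the same total length, so a modulus of absolute continuity applies to it
    whatever the partitions are. *)
Lemma ac_sum_variation_lt (R : realType) (c d : R) (f : R -> R) (e : R) :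
  abs_continuous_on c d f -> 0 < e -> exists2 delta : R, 0 < delta &
  forall (T : finType) (l r : T -> R) (s : T -> seq R),
    (forall i, [/\ c <= l i, l i <= r i & r i <= d]) ->
    trivIset [set: T] (fun i => `]l i, r i[%classic) ->
    \sum_i (r i - l i) < delta ->
    (forall i, itv_partition (l i) (r i) (s i)) ->
    \sum_i variation (l i) (r i) f (s i) < e.
Proof.
move=> acf e0; have [delta delta0 acd] := ac_fintype acf e0.
exists delta => // T l r s lr tlr lrd ps.
pose U := {i : T & 'I_(size (s i))}.
pose l' (u : U) := nth (r (tag u)) (l (tag u) :: s (tag u)) (tagged u).
pose r' (u : U) := nth (r (tag u)) (l (tag u) :: s (tag u)) (tagged u).+1.
have sumE (g : R -> R) : \sum_i variation (l i) (r i) g (s i) =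
    \sum_(u : U) `|g (r' u) - g (l' u)|.
  under eq_bigr do rewrite /variation big_mkord.
  by rewrite (@sig_big_dep _ _ _ T (fun i => 'I_(size (s i))) xpredT (fun _ => xpredT)
    (fun i j => `|g (nth (r i) (l i :: s i) j.+1) - g (nth (r i) (l i :: s i) j)|)).
have idnd (x y : R) : {in `[x, y] &, nondecreasing_fun (@idfun R)} by move=> ? ?.
have mono i a b : (a <= b)%N -> (b < (size (s i)).+1)%N ->
    nth (r i) (l i :: s i) a <= nth (r i) (l i :: s i) b.
  move=> ab bs; have [pa _] := ps i.
  by rewrite lt_sorted_leq_nth// ?inE//= (leq_ltn_trans ab).
have lelr (u : U) : l' u <= r' u by apply: mono => //; rewrite ltnS ltn_ord.
have lel (u : U) : l (tag u) <= l' u.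
  by apply: itv_partition_nth_ge => //; rewrite ltnW// ltnS ltn_ord.
have ler (u : U) : r' u <= r (tag u) by apply: itv_partition_nth_le => //; rewrite ltnS ltn_ord.
rewrite sumE; apply: acd.
- move=> u; have [cl _ rd] := lr (tag u); split => //.
    by rewrite (le_trans cl).
  by rewrite (le_trans _ rd).
- apply/trivIsetP => -[i j] [i' j'] _ _ /= ij; apply/seteqP; split => // x /=.
  rewrite !in_itv/= => -[/andP[lx xr] /andP[lx' xr']].
  have [ii'|ii'] := eqVneq i i'.
    move: ij lx xr lx' xr'; rewrite -{}ii' in j' * => jj' lx xr lx' xr'.
    have [jj|jj|jj] := ltngtP j j'.
    + have := lt_trans lx' xr; rewrite ltNge => /negP; apply.
      by apply: mono => //; rewrite ltnW// ltnS.
    + have := lt_trans lx xr'; rewrite ltNge => /negP; apply.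
      by apply: mono => //; rewrite ltnW// ltnS.
    + by move/val_inj: jj jj' => ->; rewrite eqxx.
  move/trivIsetP : tlr => /(_ i i' I I ii') /seteqP[+ _] => /(_ x); apply => /=.
  rewrite !in_itv/=; split.
    by rewrite (le_lt_trans (lel _) lx) (lt_le_trans xr (ler _)).
  by rewrite (le_lt_trans (lel _) lx') (lt_le_trans xr' (ler _)).
- have := sumE idfun; under eq_bigr do rewrite nondecreasing_variation//.
  move=> sE; apply: le_lt_trans lrd; rewrite sE.
  by apply: ler_sum => u _; rewrite ler_norm.
Qed.

(** The bound of [ac_sum_variation_lt] is uniform in the partitions and passes
    to the supremum over them. *)
Lemma ac_total_variation_small (R : realType) (c d : R) (f : R -> R) (e : R) :
  abs_continuous_on c d f -> 0 < e -> exists2 delta : R, 0 < delta &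
  forall (T : finType) (l r : T -> R),
    (forall i, [/\ c <= l i, l i <= r i & r i <= d]) ->
    trivIset [set: T] (fun i => `]l i, r i[%classic) ->
    \sum_i (r i - l i) < delta ->
    (\sum_i total_variation (l i) (r i) f <= e%:E)%E.
Proof.
move=> acf e0; have [delta delta0 acd] := ac_sum_variation_lt acf e0.
exists delta => // T l r lr tlr lrd.
have BV i : bounded_variation (l i) (r i) f.
  exists e => _ [s ps <-].
  have := acd 'I_1 (fun=> l i) (fun=> r i) (fun=> s).
  rewrite !big_ord1; move=> H; apply/ltW/H => //.
  - by apply/trivIsetP => -[[|//] ?] [[|//] ?] _ _ /eqP[]; exact: val_inj.
  - apply: le_lt_trans lrd; rewrite (bigD1 i)//= lerDl sumr_ge0// => j _.
    by have [_ + _] := lr j; rewrite subr_ge0.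
have TVfin i : total_variation (l i) (r i) f \is a fin_num.
  by apply/bounded_variationP => //; have [] := lr i.
suff H (h : R) : 0 < h ->
    (\sum_i total_variation (l i) (r i) f <= (e + h)%:E)%E.
  by apply/lee_addgt0Pr => h h0; rewrite -EFinD; exact: H.
move=> h0.
pose h' := h / (#|T|.+1)%:R.
have h'0 : 0 < h' by rewrite divr_gt0.
have /choice[s /all_and2[ps hs]] i : exists s, itv_partition (l i) (r i) s /\
    (total_variation (l i) (r i) f <= (variation (l i) (r i) f s + h')%:E)%E.
  have /ub_ereal_sup_adherent : 0 < h' by [].
  move=> /(_ _ (TVfin i)) [_ [_ [s ps <-] <-]] hs.
  by exists s; split => //; rewrite EFinD -leeBlDr// ltW.
apply: (@le_trans _ _ (\sum_i (variation (l i) (r i) f (s i) + h')%:E)%E).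
  by apply: lee_sum => i _.
rewrite sumEFin lee_fin big_split/= lerD//.
  by apply/ltW/acd.
have hE : h = h' * #|T|.+1%:R by rewrite /h' mulfVK.
rewrite sumr_const -mulr_natr [leRHS]hE ler_pM2l//.
by rewrite ler_nat; exact: leqnSn.
Qed.

(** Pieces shorter than the modulus attached to [1] have variation at most [1],
    and finitely many of them cover the segment. *)
Lemma ac_total_variation_fin_num (R : realType) (c d : R) (f : R -> R) :
  c <= d -> abs_continuous_on c d f -> total_variation c d f \is a fin_num.
Proof.
move=> cd acf; have [delta delta0 acd] := ac_total_variation_small acf ltr01.
have small x y : c <= x -> x <= y -> y <= d -> y - x < delta ->
    total_variation x y f \is a fin_num.
  move=> cx xy yd xyd; rewrite ge0_fin_numE ?total_variation_ge0//.
  have := acd 'I_1 (fun=> x) (fun=> y); rewrite !big_ord1 => H.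
  apply: le_lt_trans (ltry 1); apply: H => //.
  by apply/trivIsetP => -[[|//] ?] [[|//] ?] _ _ /eqP[]; exact: val_inj.
pose n := (Num.truncn ((d - c) / delta)).+1.
pose h := (d - c) / n%:R.
have hd : h < delta.
  rewrite /h ltr_pdivrMr ?ltr0n// -ltr_pdivrMl// mulrC.
  by rewrite truncnS_gt.
have h0 : 0 <= h by rewrite divr_ge0// subr_ge0.
have dE : d = c + n%:R * h by rewrite /h mulrCA divff ?pnatr_eq0// mulr1 subrKC.
have step k : (k <= n)%N -> total_variation c (c + k%:R * h) f \is a fin_num.
  elim: k => [_|k ih kn]; first by rewrite mul0r addr0 total_variationxx.
  have le1 : c + k%:R * h <= c + k.+1%:R * h.
    by rewrite lerD2l ler_wpM2r// ler_nat.
  have le0 : c <= c + k%:R * h by rewrite lerDl mulr_ge0.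
  rewrite (total_variationD f le0 le1) fin_numD ih 1?ltnW//=.
  apply: small => //.
  - rewrite [leRHS]dE.
    by rewrite lerD2l ler_wpM2r// ler_nat.
  - by rewrite opprD addrACA subrr add0r -mulrBl -natrB// subSnn mul1r.
by rewrite dE; exact: step.
Qed.

Lemma trivIset_ord1 (T : Type) (F : 'I_1 -> set T) : trivIset [set: 'I_1] F.
Proof. by apply/trivIsetP => i j _ _; rewrite (ord1 i) (ord1 j) eqxx. Qed.

(** By additivity, the increments of this function are total variations over
    subintervals, which [ac_total_variation_small] controls. *)
Lemma ac_variation (R : realType) (c d : R) (f : R -> R) :
  abs_continuous_on c d f ->
  abs_continuous_on c d (fun x => fine (total_variation c x f)).
Proof.
move=> acf e e0; have e20 : 0 < e / 2 by rewrite divr_gt0.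
have [delta delta0 acd] := ac_total_variation_small acf e20.
exists delta => // n l r lr tlr lrd.
have TVfin x y : c <= x -> x <= y -> y <= d -> total_variation x y f \is a fin_num.
  move=> cx xy yd; apply/bounded_variationP => //.
  apply: (bounded_variationr cx xy); apply: (bounded_variationl (le_trans cx xy) yd).
  have cd : c <= d by rewrite (le_trans cx)// (le_trans xy).
  by apply/bounded_variationP => //; exact: ac_total_variation_fin_num.
apply: (@le_lt_trans _ _ (e / 2)); last by rewrite ltr_pdivrMr// ltr_pMr// ltr1n.
rewrite -lee_fin; apply: le_trans (acd _ _ _ lr tlr lrd).
rewrite -sumEFin; apply: lee_sum => i _; have [cl llr rd] := lr i.
rewrite (total_variationD f cl llr) fineD ?TVfin//; last exact: le_trans rd.
rewrite addrAC subrr add0r ger0_norm ?fine_ge0 ?total_variation_ge0//.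
by rewrite fineK ?TVfin.
Qed.

(** * The fundamental theorem of calculus for absolutely continuous functions *)

(** The retraction onto the segment.  Composition with it extends a function on
    the segment to a function that is constant on both sides of it. *)
Definition clip (R : realType) (c d x : R) : R := Num.max c (Num.min x d).

Lemma clip_in (R : realType) (c d x : R) : c <= d -> c <= clip c d x /\ clip c d x <= d.
Proof. by move=> cd; rewrite /clip le_max lexx ge_max cd ge_min lexx orbT. Qed.

Lemma clip_id (R : realType) (c d x : R) : c <= x -> x <= d -> clip c d x = x.
Proof. by move=> cx xd; rewrite /clip min_l// max_r. Qed.

Lemma clip_le (R : realType) (c d : R) : {homo clip c d : x y / x <= y}.
Proof. by move=> x y xy; rewrite /clip le_max2// le_min2. Qed.

Lemma clip_lip (R : realType) (c d x y : R) : c <= d -> x <= y -> clip c d y - clip c d x <= y - x.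
Proof.
move=> cd xy; rewrite /clip /Num.max /Num.min.
by case: (ltP x d) => xd; case: (ltP y d) => yd; case: ltP => ?; case: ltP => ?; lra.
Qed.

Lemma clip_itv_sub (R : realType) (c d x y : R) : c <= d ->
  `]clip c d x, clip c d y[%classic `<=` `]x, y[%classic.
Proof.
move=> cd z; rewrite /= !in_itv/= => /andP[xz zy].
have [cx _] := clip_in x cd; have [_ yd] := clip_in y cd.
have zE : clip c d z = z by apply: clip_id; lra.
apply/andP; split; rewrite ltNge; apply/negP => /(clip_le c d); rewrite zE.
- by rewrite leNgt xz.
- by rewrite leNgt zy.
Qed.

Lemma lebesgue_stieltjes_measure_ocitv (R : realType) (f : cumulative R R) (a b : R) :
  a <= b -> lebesgue_stieltjes_measure f `]a, b]%classic = (f b - f a)%:E.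
Proof.
move=> ab; rewrite /lebesgue_stieltjes_measure /measure_extension.
by rewrite measurable_mu_extE/=; [rewrite wlength_itv_bnd|exact: is_ocitv].
Qed.

Lemma open_bounded_interval_itv (R : realType) (O : set R) : open O -> is_interval O ->
  has_lbound O -> has_ubound O -> O = `](inf O), (sup O)[%classic.
Proof.
move=> oO iO lO uO; have := interval_bounded_interior iO lO uO.
move/interior_id : (oO) => -> OE; rewrite {1}OE; apply/seteqP.
by split => x /=; rewrite in_itv.
Qed.

Lemma ac_continuous_clip (R : realType) (c d : R) (f : R -> R) : c <= d ->
  abs_continuous_on c d f -> continuous (f \o clip c d).
Proof.
move=> cd acf x; apply/cvgrPdist_lt => e e0.
have [delta delta0 acd] := ac_fintype acf e0.
have H y z : y <= z -> z - y < delta -> `|f (clip c d z) - f (clip c d y)| < e.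
  move=> yz yzd; have := acd 'I_1 (fun=> clip c d y) (fun=> clip c d z).
  rewrite !big_ord1; apply.
  - by move=> _; split; [exact: (clip_in _ cd).1|exact: clip_le|exact: (clip_in _ cd).2].
  - exact: trivIset_ord1.
  - by apply: le_lt_trans yzd; exact: clip_lip.
near=> y; have : `|x - y| < delta by near: y; apply: cvgr_dist_lt.
have [xy|yx] := leP x y => xyd /=.
- by rewrite distrC; apply: H => //; move: xyd; rewrite distrC ger0_norm// subr_ge0.
- by apply: H; [exact: ltW|move: xyd; rewrite gtr0_norm// subr_gt0].
Unshelve. all: by end_near. Qed.

(** A Lebesgue null set lies in an open set of small length, which is a disjoint
    union of open intervals.  Absolute continuity makes the Stieltjes measure of
    finitely many of them small, hence that of the open set.  So the Stieltjes
    measure is dominated by the Lebesgue measure and has a density. *)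
Lemma nondecreasing_ac_density (R : realType) (c d : R) (W : R -> R) : c <= d ->
  {in `[c, d] &, {homo W : x y / x <= y}} -> abs_continuous_on c d W ->
  exists k : R -> R, [/\ forall x, 0 <= k x,
    (@lebesgue_measure R).-integrable setT (EFin \o k) &
    forall x, c <= x -> x <= d ->
      (\int[lebesgue_measure]_(t in `[c, x]) (k t)%:E = (W x - W c)%:E)%E].
Proof.
move=> cd ndW acW.
pose V := W \o clip c d.
have cinI x : clip c d x \in `[c, d].
  by rewrite in_itv/=; have [-> ->] := clip_in x cd.
have ndV : nondecreasing V.
  by move=> x y xy; apply: ndW => //; exact: clip_le.
have rcV : right_continuous V.
  exact/right_continuousW/ac_continuous_clip.
pose F : cumulative R R := HB.pack_for (cumulative R R) V (isCumulative.Build R _ R V ndV rcV).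
pose L := lebesgue_stieltjes_measure F.
(* A bounded open set, so that the restricted Stieltjes measure is finite and
   the components of an open subset of it are bounded intervals. *)
pose E := `](c - 1), (d + 1)[%classic : set (measurableTypeR R).
have mE : measurable E by exact: measurable_itv.
have Ecd x : x <= d -> `]c, x]%classic `<=` E.
  move=> xd z; rewrite /E /= !in_itv/= => /andP[cz zx]; apply/andP; split; lra.
have LE : (L E < +oo)%E.
  apply: (@le_lt_trans _ _ (L `](c - 1), (d + 1)]%classic)).
    apply: le_measure; rewrite ?inE//.
    exact: subset_itv_oo_oc.
  by rewrite /L lebesgue_stieltjes_measure_ocitv ?ltry//; lra.
pose nu := mfrestr mE LE.
have nuleb : nu `<< (@lebesgue_measure R).
  apply/null_content_dominatesP => A mA A0.
  apply/eqP; rewrite eq_le measure_ge0 andbT.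
  suff H (e : R) : 0 < e -> (nu A <= e%:E)%E.
    by apply/lee_addgt0Pr => e e0; rewrite add0e; exact: H.
  move=> e0.
  have [delta delta0 acd] := ac_fintype acW e0.
  have [U [oU AU Ud]] : exists U : set R,
      [/\ open U, A `<=` U & (lebesgue_measure U < delta%:E)%E].
    have [|U [oU AU Ud]] := lebesgue_regularity_outer mA _ delta0.
      by rewrite [X in (X < _)%E]A0 ltry.
    exists U; split => //; apply: le_lt_trans Ud.
    rewrite -{1}(setDKU AU) (le_trans (outer_measureU2 _ _ _))//.
    by rewrite [X in (_ + X)%E]A0 adde0.
  have oUE : open (U `&` E) by apply: openI => //; exact: interval_open.
  pose O := open_disjoint_itv oUE.
  have mO q : measurable (O q) by apply: open_measurable; exact: open_disjoint_itv_open.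
  have OE q : O q `<=` E.
    apply: subset_trans (@subIsetr _ U E).
    by rewrite [X in _ `<=` X](open_disjoint_itv_bigcup oUE); exact: bigcup_sup.
  pose l q := inf (O q); pose r q := sup (O q).
  have Olr q : O q = `]l q, r q[%classic.
    apply: open_bounded_interval_itv.
    - exact: open_disjoint_itv_open.
    - exact: open_disjoint_itv_is_interval.
    - by exists (c - 1) => z /OE; rewrite /E/= in_itv/= => /andP[/ltW].
    - by exists (d + 1) => z /OE; rewrite /E/= in_itv/= => /andP[_ /ltW].
  have lr q : l q <= r q.
    have [Oq0|/set0P[z]] := eqVneq (O q) set0; first by rewrite /l /r Oq0 inf0 sup0.
    by rewrite Olr/= in_itv/= => /andP[/lt_trans /[apply] /ltW].
  have lenO q : lebesgue_measure (O q) = (r q - l q)%:E.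
    rewrite Olr lebesgue_measure_itv/= lte_fin; case: ifPn => [_|].
      by rewrite -EFinB.
    rewrite -leNgt => rl; have -> : r q = l q by apply/eqP; rewrite eq_le rl lr.
    by rewrite subrr.
  have tO : trivIset setT O by exact: open_disjoint_itv_trivIset.
  have sumE (m : {measure set (measurableTypeR R) -> \bar R}) :
      m (U `&` E) = (\sum_(0 <= i <oo) m (O i))%E.
    rewrite [in LHS](open_disjoint_itv_bigcup oUE) measure_bigcup//; last by move=> i _; exact: mO.
    by apply: eq_eseriesl => i; rewrite in_setT.
  have LO q : (L (O q) <= (W (clip c d (r q)) - W (clip c d (l q)))%:E)%E.
    rewrite -[leRHS](lebesgue_stieltjes_measure_ocitv F (lr q)).
    apply: le_measure; rewrite ?inE//; first exact: mO.
    by rewrite Olr; exact: subset_itv_oo_oc.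
  have sum_lt n : \sum_(i < n) (W (clip c d (r i)) - W (clip c d (l i))) < e.
    have := acd 'I_n (fun i => clip c d (l i)) (fun i => clip c d (r i)).
    move=> H; apply: (@le_lt_trans _ _ (\sum_(i < n) `|W (clip c d (r i)) - W (clip c d (l i))|)).
      by apply: ler_sum => i _; exact: ler_norm.
    apply: H.
    - by move=> i; split; [exact: (clip_in _ cd).1|exact: clip_le|exact: (clip_in _ cd).2].
    - apply/trivIsetP => i j _ _ ij; move/trivIsetP : tO => /(_ i j I I ij).
      by rewrite !Olr; apply: subsetI_eq0; exact: clip_itv_sub.
    - rewrite -lte_fin; apply: le_lt_trans Ud.
      apply: (@le_trans _ _ (lebesgue_measure (U `&` E))).
        rewrite sumE; apply: le_trans (nneseries_lim_ge n _) => //.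
        rewrite big_mkord -sumEFin; apply: lee_sum => i _.
        by rewrite [leRHS](lenO i) lee_fin clip_lip.
      by apply: le_measure; rewrite ?inE//; [exact: open_measurable|exact: open_measurable].
  apply: (@le_trans _ _ (L (U `&` E))).
    rewrite /nu/=/mfrestr/mrestr.
    apply: le_measure; rewrite ?inE//; [exact: measurableI|exact: open_measurable|].
    exact: setSI.
  rewrite /L (sumE (lebesgue_stieltjes_measure F)); apply: lime_le; first exact: is_cvg_nneseries.
  apply: nearW => n; rewrite big_mkord.
  apply: (@le_trans _ _ (\sum_(i < n) (W (clip c d (r i)) - W (clip c d (l i))))%:E); last first.
    by rewrite lee_fin ltW.
  by rewrite -sumEFin; apply: lee_sum => i _.
have [f [f0 ffin fint fE]] := radon_nikodym_sigma_finite nuleb.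
exists (fine \o f); split.
- by move=> x; rewrite fine_ge0.
- by rewrite (_ : EFin \o (fine \o f) = f)//; apply/funext => x /=; rewrite fineK.
move=> x cx xd.
have mf : measurable_fun setT f by case/integrableP : fint.
under eq_integral => t _ do rewrite /= fineK//.
rewrite -integral_itv_obnd_cbnd; last exact: measurable_funTS.
rewrite -fE; last exact: measurable_itv.
rewrite /nu/= /mfrestr /mrestr setIidl; last exact: Ecd.
rewrite [LHS](lebesgue_stieltjes_measure_ocitv F cx).
by rewrite /F/= /V/= !clip_id.
Qed.

Lemma acB (R : realType) (c d : R) (f g : R -> R) :
  abs_continuous_on c d f -> abs_continuous_on c d g ->
  abs_continuous_on c d (fun x => f x - g x).
Proof.
move=> acf acg e e0; have e20 : 0 < e / 2 by rewrite divr_gt0.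
have [df df0 Hf] := acf _ e20; have [dg dg0 Hg] := acg _ e20.
exists (Num.min df dg) => [|n l r lr tlr]; first by rewrite lt_min df0.
rewrite lt_min => /andP[lrf lrg].
rewrite (splitr e); apply: le_lt_trans (ltrD (Hf _ _ _ lr tlr lrf) (Hg _ _ _ lr tlr lrg)).
rewrite -big_split/=; apply: ler_sum => i _.
rewrite (_ : _ - _ = (f (r i) - f (l i)) - (g (r i) - g (l i))); last by ring.
exact: ler_normB.
Qed.

Lemma ac_bounded (R : realType) (c d : R) (f : R -> R) : c <= d ->
  abs_continuous_on c d f -> exists2 B : R, 0 < B & forall x, c <= x -> x <= d -> `|f x| <= B.
Proof.
move=> cd acf; have TV := ac_total_variation_fin_num cd acf.
exists (`|f c| + fine (total_variation c d f) + 1).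
  by rewrite ltr_wpDl// addr_ge0// fine_ge0// total_variation_ge0.
move=> x cx xd; rewrite -(subrKC (f c) (f x)) (le_trans (ler_normD _ _))//.
rewrite -addrA lerD2l// ler_wpDr// -lee_fin fineK//.
apply: (le_trans (total_variation_ge f cx)).
by rewrite (total_variationD f cx xd) leeDl// total_variation_ge0.
Qed.

Lemma acM (R : realType) (c d : R) (f g : R -> R) : c <= d ->
  abs_continuous_on c d f -> abs_continuous_on c d g ->
  abs_continuous_on c d (fun x => f x * g x).
Proof.
move=> cd acf acg e e0.
have [Bf Bf0 Hf] := ac_bounded cd acf; have [Bg Bg0 Hg] := ac_bounded cd acg.
have ef : 0 < e / 2 / Bg by rewrite !divr_gt0.
have eg : 0 < e / 2 / Bf by rewrite !divr_gt0.
have [df df0 Hdf] := acf _ ef; have [dg dg0 Hdg] := acg _ eg.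
exists (Num.min df dg) => [|n l r lr tlr]; first by rewrite lt_min df0.
rewrite lt_min => /andP[lrf lrg].
have {Hdf}Hdf := Hdf _ _ _ lr tlr lrf; have {Hdg}Hdg := Hdg _ _ _ lr tlr lrg.
rewrite ltr_pdivlMr// in Hdf; rewrite ltr_pdivlMr// in Hdg.
rewrite (splitr e); apply: le_lt_trans (ltrD Hdf Hdg).
rewrite !mulr_suml -big_split/=; apply: ler_sum => i _.
have [cl llr rd] := lr i.
rewrite (_ : _ - _ = (f (r i) - f (l i)) * g (r i) + (g (r i) - g (l i)) * f (l i)); last by ring.
rewrite (le_trans (ler_normD _ _))// !normrM lerD// ler_wpM2l//.
- by rewrite Hg// (le_trans cl).
- by rewrite Hf// (le_trans llr).
Qed.

Lemma lipschitz_ac (R : realType) (c d K : R) (f : R -> R) :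
  (forall x y, c <= x -> x <= y -> y <= d -> `|f y - f x| <= K * (y - x)) ->
  abs_continuous_on c d f.
Proof.
move=> lip e e0; have K1 : 0 < `|K| + 1 by rewrite ltr_wpDl.
exists (e / (`|K| + 1)) => [|n l r lr tlr]; first by rewrite divr_gt0.
rewrite ltr_pdivlMr// => lre; apply: le_lt_trans lre.
rewrite mulr_suml; apply: ler_sum => i _; have [cl llr rd] := lr i.
rewrite (le_trans (lip _ _ cl llr rd))// mulrC ler_wpM2l ?subr_ge0//.
by rewrite (le_trans (ler_norm K))// lerDl.
Qed.

(** With [V] the variation function of [F], both [V] and [V - F] are
    nondecreasing and absolutely continuous; [k] is the difference of their
    densities, and the derivative exists at the Lebesgue points of [k]. *)
Lemma ac_ftc (R : realType) (c d : R) (F : R -> R) : c <= d ->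
  abs_continuous_on c d F -> exists k : R -> R, [/\
    (@lebesgue_measure R).-integrable setT (EFin \o k),
    (forall x, c <= x -> x <= d ->
      (\int[lebesgue_measure]_(t in `[c, x]) (k t)%:E = (F x - F c)%:E)%E) &
    {ae lebesgue_measure, forall x, c < x -> x < d -> is_derive x 1 F (k x)}].
Proof.
move=> cd acF; pose V x := fine (total_variation c x F).
have acV : abs_continuous_on c d V by exact: ac_variation.
have Vfin x y : c <= x -> x <= y -> y <= d -> total_variation x y F \is a fin_num.
  move=> cx xy yd; apply/bounded_variationP => //.
  apply: (bounded_variationr cx xy); apply: (bounded_variationl (le_trans cx xy) yd).
  by apply/bounded_variationP => //; exact: ac_total_variation_fin_num.
have VD x y : c <= x -> x <= y -> y <= d -> `|F y - F x| <= V y - V x.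
  move=> cx xy yd; rewrite -lee_fin (le_trans (total_variation_ge F xy))//.
  rewrite /V (total_variationD F cx xy) fineD ?Vfin//; last exact: le_trans yd.
  by rewrite addrAC subrr add0r fineK// Vfin.
have [|k1 [k10 ik1 k1E]] := nondecreasing_ac_density cd _ acV.
  move=> x y; rewrite !in_itv/= => /andP[cx xd] /andP[cy yd] xy.
  by rewrite -subr_ge0 (le_trans _ (VD _ _ cx xy yd)).
have [|k2 [k20 ik2 k2E]] := nondecreasing_ac_density cd _ (acB acV acF).
  move=> x y; rewrite !in_itv/= => /andP[cx xd] /andP[cy yd] xy.
  by have := VD _ _ cx xy yd; rewrite ler_norml; lra.
pose k x := k1 x - k2 x.
have ik : (@lebesgue_measure R).-integrable setT (EFin \o k).
  by rewrite (_ : _ \o _ = (EFin \o k1) \- (EFin \o k2))%E//; exact: integrableB.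
have kE x : c <= x -> x <= d ->
    (\int[lebesgue_measure]_(t in `[c, x]) (k t)%:E = (F x - F c)%:E)%E.
  move=> cx xd; under eq_integral do rewrite EFinB.
  rewrite integralB//; last 2 first.
    exact: integrableS ik1.
    exact: integrableS ik2.
  by rewrite k1E// k2E// -EFinB; congr EFin; ring.
exists k; split => //.
have := @FTC1 R k (BLeft c) => /(_ _ _)[].
- by move=> y; exact: integrableS ik.
- by apply: open_integrable_locally => //; exact: openT.
move=> N [mN N0 Nsub]; exists N; split => //; apply: subset_trans Nsub.
apply: subsetC => x /= Hx cx xd; have [|dF dE] := Hx _; first by rewrite lte_fin.
have dI : is_derive x 1 (fun y => Rintegral lebesgue_measure `[c, y] k) (k x).
  by split; [exact: dF|rewrite -[RHS]dE [RHS]derive1E].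
have := is_deriveD (is_derive_cst (F c) x 1) dI; rewrite add0r.
apply: near_eq_is_derive; near=> y.
rewrite fctE/= /Rintegral kE/= ?subrKC//.
- by apply: ltW; near: y; exact: lt_nbhsr.
- by apply: ltW; near: y; exact: lt_nbhsl.
Unshelve. all: by end_near. Qed.

(** * Measures with a density, and integrals of nonmeasurable functions *)

Definition with_density d (T : measurableType d) (R : realType)
    (la : {measure set T -> \bar R}) (r : T -> R) (A : set T) : \bar R :=
  (\int[la]_(x in A) (r x)%:E)%E.

Lemma with_density0 d (T : measurableType d) (R : realType)
  (la : {measure set T -> \bar R}) (r : T -> R) : with_density la r set0 = 0%E.
Proof. exact: integral_set0. Qed.

Lemma with_density_ge0 d (T : measurableType d) (R : realType)
  (la : {measure set T -> \bar R}) (r : T -> R) :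
  (forall x, 0 <= r x) -> forall A, (0 <= with_density la r A)%E.
Proof. by move=> r0 A; apply: integral_ge0 => x _; rewrite lee_fin. Qed.

Lemma with_density_sigma_additive d (T : measurableType d) (R : realType)
  (la : {measure set T -> \bar R}) (r : T -> R) :
  measurable_fun setT r -> (forall x, 0 <= r x) ->
  semi_sigma_additive (with_density la r).
Proof.
move=> mr r0; apply: semi_sigma_additive_nng_induced; first exact/measurable_EFinP.
by move=> x; rewrite lee_fin.
Qed.

Definition with_density_measure d (T : measurableType d) (R : realType)
    (la : {measure set T -> \bar R}) (r : T -> R)
    (mr : measurable_fun setT r) (r0 : forall x, 0 <= r x) :
    {measure set T -> \bar R} :=
  HB.pack_for (Measure.type T R) (with_density la r)
    (isMeasure.Build d T R (with_density la r) (with_density0 la r)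
      (with_density_ge0 la r0) (with_density_sigma_additive mr r0)).

Lemma integral_with_density_nnsfun d (T : measurableType d) (R : realType)
  (la : {measure set T -> \bar R}) (r : T -> R) (E : set T) (h : {nnsfun T >-> R}) :
  measurable_fun setT r -> (forall x, 0 <= r x) -> measurable E ->
  (\int[with_density la r]_(x in E) (h x)%:E = \int[la]_(x in E) ((h x * r x)%:E))%E.
Proof.
move=> mr r0 mE; rewrite -[with_density la r]/(with_density_measure la mr r0 : set T -> \bar R).
set m := with_density_measure la mr r0.
have mh y : measurable (h @^-1` [set y]) by exact: measurable_sfunP.
have mind y : measurable_fun E (fun x => (y * \1_(h @^-1` [set y]) x)%:E).
  apply/measurable_EFinP; apply: measurable_funM => //.
transitivity (\int[m]_(x in E) (\sum_(y \in range h) (y * \1_(h @^-1` [set y]) x)%:E))%E.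
  by apply: eq_integral => x _; rewrite fsumEFin// -fimfunE.
transitivity (\int[la]_(x in E) (\sum_(y \in range h) (y * \1_(h @^-1` [set y]) x * r x)%:E))%E; last first.
  apply: eq_integral => x _; rewrite fsumEFin// -mulr_fsuml.
  by rewrite -fimfunE.
rewrite ge0_integral_fsum//; last by move=> y x _; exact: nnfun_muleindic_ge0.
rewrite ge0_integral_fsum//; last 2 first.
- move=> y; apply/measurable_EFinP/measurable_funM; first by have /measurable_EFinP := mind y.
  exact: measurable_funTS.
- by move=> y x _; rewrite EFinM mule_ge0 ?lee_fin// -lee_fin; exact: nnfun_muleindic_ge0.
apply: eq_fsbigr => y /[!inE] -[x _ hxy].
have y0 : 0 <= y by rewrite -hxy.
under eq_integral do rewrite EFinM.
rewrite ge0_integralZl//; last exact/measurable_EFinP/measurable_indic.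
rewrite integral_indic//.
under [RHS]eq_integral do rewrite -mulrA EFinM.
rewrite [RHS]ge0_integralZl//; last 2 first.
  apply/measurable_EFinP/measurable_funM => //; exact: measurable_funTS.
  by move=> x' _; rewrite lee_fin mulr_ge0.
congr (_ * _)%E.
rewrite /m/= /with_density setIC integral_mkcondr.
apply: eq_integral => x' _; rewrite epatch_indic.
by rewrite EFinM muleC.
Qed.

Lemma integral_with_density d (T : measurableType d) (R : realType)
  (la : {measure set T -> \bar R}) (r : T -> R) (E : set T) (f : T -> \bar R) :
  measurable_fun setT r -> (forall x, 0 <= r x) -> measurable E ->
  (forall x, E x -> 0 <= f x)%E -> measurable_fun E f ->
  (\int[with_density la r]_(x in E) f x = \int[la]_(x in E) (f x * (r x)%:E))%E.
Proof.
move=> mr r0 mE f0 mf; pose h := nnsfun_approx mE mf.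
have fE x : E x -> (EFin \o h ^~ x) n @[n --> \oo] --> f x.
  by move=> Ex; exact: cvg_nnsfun_approx.
have ndh x : {homo (fun n => h n x) : a b / (a <= b)%N >-> a <= b}.
  by move=> a b ab; exact/lefP/nd_nnsfun_approx.
have -> : (\int[with_density la r]_(x in E) f x =
    limn (fun n => \int[with_density la r]_(x in E) (h n x)%:E))%E.
  rewrite -[with_density la r]/(with_density_measure la mr r0 : set T -> \bar R).
  rewrite -monotone_convergence//.
  - by apply: eq_integral => x /[!inE] Ex; apply/esym/cvg_lim => //; exact: fE.
  - by move=> n; apply/measurable_EFinP; exact: measurable_funTS.
  - by move=> n x _; rewrite lee_fin.
  - by move=> x Ex a b ab; rewrite lee_fin ndh.
under eq_fun do rewrite integral_with_density_nnsfun//.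
rewrite -monotone_convergence//.
- apply: eq_integral => x /[!inE] Ex; apply/cvg_lim => //.
  under eq_fun do rewrite EFinM.
  by apply: cvgeZr => //; exact: fE.
- by move=> n; apply/measurable_EFinP/measurable_funM; exact: measurable_funTS.
- by move=> n x _; rewrite lee_fin mulr_ge0.
- by move=> x Ex a b ab; rewrite lee_fin ler_wpM2r// ndh.
Qed.

(** The function [F] may fail to be measurable: its integral is the supremum of
    the integrals of the simple functions below it, and discarding a null set
    from the domain of [P] puts all simple functions below [P] below [F]. *)
Lemma ge0_le_integral_ae d (T : measurableType d) (R : realType)
  (la : {measure set T -> \bar R}) (D E : set T) (P F : T -> \bar R) :
  measurable D -> D `<=` E -> measurable_fun D P ->
  (forall x, D x -> 0 <= P x)%E -> (forall x, E x -> 0 <= F x)%E ->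
  {ae la, forall x, D x -> P x <= F x}%E ->
  (\int[la]_(x in D) P x <= \int[la]_(x in E) F x)%E.
Proof.
move=> mD DE mP P0 F0 [N [mN N0 PFN]].
rewrite (ge0_negligible_integral mN mD mP P0 N0) !ge0_integralE//; last first.
  by move=> x [Dx _]; exact: P0.
apply: le_ereal_sup => _ [h /= hP <-]; exists h => // x; apply: le_trans (hP x) _.
rewrite !patchE in_setD; case: ifPn => [/andP[Dx]|_]; last first.
  by case: ifPn => // /[!inE]; exact: F0.
have Ex : x \in E by apply/mem_set/DE/set_mem.
rewrite Ex notin_setE => Nx; apply: contrapT => PF; apply: Nx; apply: PFN => /= H.
by apply: PF; apply: H; exact: set_mem.
Qed.

(** * Primitives of continuous functions *)

(** Two-sided continuity at every point, the form in which continuity on an open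
    set enters the rules of differential calculus. *)
Definition continuous_on (R : realType) (I : set R) (f : R -> R) : Prop :=
  forall x, I x -> {for x, continuous f}.

Lemma continuous_on_integrable (R : realType) (I : set R) (f : R -> R) (x y : R) :
  is_interval I -> continuous_on I f -> I x -> I y ->
  (@lebesgue_measure R).-integrable `[x, y] (EFin \o f).
Proof.
move=> iI cf Ix Iy; apply: continuous_compact_integrable; first exact: segment_compact.
apply: continuous_in_subspaceT => z; rewrite inE/= in_itv/= => xzy.
by apply: cf; exact: iI xzy.
Qed.

(** The oriented integral, with the same branches as [Cfun]: the function
    [Cfun a b x0] is [primitive (fun u => b u / a u) x0] by conversion. *)
Definition primitive (R : realType) (f : R -> R) (t x : R) : R :=
  if t <= x then \int[lebesgue_measure]_(u in `[t, x]) f u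
  else - \int[lebesgue_measure]_(u in `[x, t]) f u.

Lemma Rintegral_itv_split (R : realType) (f : R -> R) (x y z : R) :
  x <= y -> y <= z -> (@lebesgue_measure R).-integrable `[x, z] (EFin \o f) ->
  \int[lebesgue_measure]_(u in `[x, z]) f u =
  \int[lebesgue_measure]_(u in `[x, y]) f u + \int[lebesgue_measure]_(u in `[y, z]) f u.
Proof.
move=> xy yz fi; rewrite -[X in _ + X]Rintegral_itv_obnd_cbnd.
  by rewrite -(Rintegral_itvB fi)// subrKC.
by apply: integrableS fi => //; apply: subset_itv; rewrite bnd_simp.
Qed.

(** Measuring from a point [c] to the left of both [t] and [x] makes the case
    distinction of the oriented integral disappear. *)
Lemma primitiveE (R : realType) (I : set R) (f : R -> R) (c t x : R) :
  is_interval I -> continuous_on I f -> I c -> I t -> I x -> c <= t -> c <= x ->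
  primitive f t x = \int[lebesgue_measure]_(u in `[c, x]) f u
                    - \int[lebesgue_measure]_(u in `[c, t]) f u.
Proof.
move=> iI cf Ic It Ix ct cx; rewrite /primitive; case: ifPn => [tx|].
  rewrite (Rintegral_itv_split ct tx); last exact: continuous_on_integrable cf Ic Ix.
  by ring.
rewrite -ltNge => /ltW xt.
rewrite (Rintegral_itv_split cx xt); last exact: continuous_on_integrable cf Ic It.
by ring.
Qed.

Lemma primitiveB (R : realType) (I : set R) (f : R -> R) (t x y : R) :
  is_interval I -> continuous_on I f -> I t -> I x -> I y -> x <= y ->
  primitive f t y - primitive f t x = \int[lebesgue_measure]_(u in `[x, y]) f u.
Proof.
move=> iI cf It Ix Iy xy; have Im : I (Num.min x t) by rewrite /Num.min; case: ifP.
have mx : Num.min x t <= x by rewrite ge_min lexx.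
have mt : Num.min x t <= t by rewrite ge_min lexx orbT.
rewrite !(primitiveE iI cf Im)// ?(le_trans mx)//.
rewrite (Rintegral_itv_split mx xy); last exact: continuous_on_integrable cf Im Iy.
by ring.
Qed.

Lemma primitive_refl (R : realType) (f : R -> R) (t : R) : primitive f t t = 0.
Proof. by rewrite /primitive lexx set_itv1 Rintegral_set1. Qed.

Lemma is_derive_primitive (R : realType) (I : set R) (f : R -> R) (t x : R) :
  open I -> is_interval I -> continuous_on I f -> I t -> I x ->
  is_derive x 1 (primitive f t) (f x).
Proof.
move=> oI iI cf It Ix.
have [e /= e0 He] : exists2 e : R, 0 < e & ball x e `<=` I.
  by have /nbhs_ballP := open_nbhs_nbhs (conj oI Ix).
have Iu : I (x + e / 2).
  by apply: He; rewrite /ball/= opprD addrA subrr add0r normrN gtr0_norm; lra.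
have Il : I (x - e / 2).
  by apply: He; rewrite /ball/= opprD addrA subrr add0r opprK gtr0_norm; lra.
pose c := Num.min (x - e / 2) t.
have Ic : I c by rewrite /c /Num.min; case: ifP.
have cx : c < x by rewrite /c gt_min; apply/orP; left; lra.
have ct : c <= t by rewrite ge_min lexx orbT.
have [|dF dE] := continuous_FTC1_closed (_ : x < x + e / 2) (continuous_on_integrable iI cf Ic Iu) cx (cf _ Ix).
  lra.
have dI : is_derive x 1 (fun y => \int[lebesgue_measure]_(u in `[c, y]) f u) (f x).
  by split; [exact: dF|rewrite -[RHS]dE [RHS]derive1E].
have := is_deriveB dI (is_derive_cst (\int[lebesgue_measure]_(u in `[c, t]) f u) x 1).
rewrite subr0; apply: near_eq_is_derive; near=> y.
rewrite fctE/= -(primitiveE iI cf Ic It)//.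
- by apply: He; near: y; apply: nbhsx_ballx.
- by apply: ltW; near: y; exact: lt_nbhsr.
Unshelve. all: by end_near. Qed.

Lemma is_derive1_continuous (R : realType) (f : R -> R) (x df : R) :
  is_derive x 1 f df -> {for x, continuous f}.
Proof. by move=> [d _]; apply: differentiable_continuous; exact/derivable1_diffP. Qed.

(** * Riccati supersolutions and the energy *)

Lemma C1_ac (R : realType) (f df : R -> R) (c d : R) : c <= d ->
  (forall x, c <= x -> x <= d -> is_derive x 1 f (df x)) ->
  (forall x, c <= x -> x <= d -> {for x, continuous df}) ->
  abs_continuous_on c d f.
Proof.
move=> cd fdf cdf.
have [|z _ zmax] := @EVT_max R (fun x => `|df x|) c d cd.
  apply: continuous_in_subspaceT => x; rewrite inE/= in_itv/= => /andP[cx xd].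
  by apply: continuous_comp; [exact: cdf|exact: norm_continuous].
apply: (@lipschitz_ac _ _ _ `|df z|) => x y cx xy yd.
have [||t] := @MVT_segment R f df x y xy.
- move=> t; rewrite in_itv/= => /andP[xt ty].
  by apply: fdf; [rewrite (le_trans cx)// ltW|rewrite (le_trans _ yd)// ltW].
- apply: continuous_in_subspaceT => t; rewrite inE/= in_itv/= => /andP[xt ty].
  by apply/is_derive1_continuous/fdf; [exact: le_trans xt|exact: le_trans yd].
rewrite in_itv/= => /andP[xt ty] ->; rewrite normrM (ger0_norm (_ : 0 <= y - x)) ?subr_ge0//.
rewrite ler_wpM2r ?subr_ge0//; apply: zmax.
by rewrite in_itv/= (le_trans cx xt) (le_trans ty).
Qed.

Lemma ac_within_continuous (R : realType) (c d : R) (f : R -> R) : c <= d ->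
  abs_continuous_on c d f -> {within `[c, d], continuous f}.
Proof.
move=> cd acf; have cf := ac_continuous_clip cd acf.
apply: (@subspace_eq_continuous _ _ _ (f \o clip c d)).
  by move=> x; rewrite inE/= in_itv/= => /andP[cx xd] /=; rewrite clip_id.
exact: continuous_subspaceT.
Qed.

Lemma ae_neq (R : realType) (c : R) : {ae (@lebesgue_measure R), forall x, x != c}.
Proof.
exists [set c]; split => //; first exact: lebesgue_measure_set1.
by move=> x /= /negP; rewrite negbK => /eqP.
Qed.

Lemma lebesgue_ae_and (R : realType) (P Q : R -> Prop) :
  {ae (@lebesgue_measure R), forall x, P x} ->
  {ae (@lebesgue_measure R), forall x, Q x} ->
  {ae (@lebesgue_measure R), forall x, P x /\ Q x}.
Proof.
have F := ae_filter_ringOfSetsType (@lebesgue_measure R).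
by move=> HP HQ; apply: filterS (filterI HP HQ).
Qed.

Lemma lebesgue_ae_imply (R : realType) (P Q : R -> Prop) :
  (forall x, P x -> Q x) ->
  {ae (@lebesgue_measure R), forall x, P x} ->
  {ae (@lebesgue_measure R), forall x, Q x}.
Proof.
have F := ae_filter_ringOfSetsType (@lebesgue_measure R).
by move=> PQ; exact: filterS.
Qed.

Lemma is_derive1_unique (R : realType) (f : R -> R) (x a b : R) :
  is_derive x 1 f a -> is_derive x 1 f b -> a = b.
Proof. by move=> [_ <-] [_ <-]. Qed.

(** The function [G^2 w] is absolutely continuous with derivative
    [2 G k w + G^2 w'], and by the Riccati inequality
    [k^2 / n - (G^2 w)' - s m G^2] is at least [(k - n w G)^2 / n]. *)
Lemma riccati_energy_bound (R : realType) (c d s : R) (m n w dw G k : R -> R) :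
  c <= d -> 0 <= s ->
  (forall x, c <= x -> x <= d -> {for x, continuous m}) ->
  (forall x, c <= x -> x <= d -> 0 < n x) ->
  (forall x, c <= x -> x <= d -> is_derive x 1 w (dw x)) ->
  (forall x, c <= x -> x <= d -> {for x, continuous dw}) ->
  (forall x, c < x -> x < d -> dw x + n x * w x ^+ 2 + s * m x <= 0) ->
  abs_continuous_on c d G ->
  {ae lebesgue_measure, forall x, c < x -> x < d -> is_derive x 1 G (k x)} ->
  (\int[lebesgue_measure]_(x in `[c, d]) (s * m x * G x ^+ 2)%:E +
     (G d ^+ 2 * w d - G c ^+ 2 * w c)%:E <=
   \int[lebesgue_measure]_(x in `[c, d]) (k x ^+ 2 / n x)%:E)%E.
Proof.
move=> cd s0 cm n0 wdw cdw ric acG Gk.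
have acw : abs_continuous_on c d w by exact: C1_ac wdw cdw.
have acP : abs_continuous_on c d (fun x => G x * G x * w x).
  by apply: acM => //; exact: acM.
have [q [iq qE Pq]] := ac_ftc cd acP.
have iqcd : (@lebesgue_measure R).-integrable `[c, d] (EFin \o q).
  exact: integrableS iq.
have wG : {within `[c, d], continuous G} by exact: ac_within_continuous.
have imG : (@lebesgue_measure R).-integrable `[c, d] (EFin \o (fun x => s * m x * G x ^+ 2)).
  apply: continuous_compact_integrable; first exact: segment_compact.
  have wm : {within `[c, d], continuous m}.
    apply: continuous_in_subspaceT => x; rewrite inE/= in_itv/= => /andP[cx xd].
    exact: cm.
  move=> x; apply: cvgM; first by apply: cvgM; [exact: cvg_cst|exact: wm].
  by apply: cvgM; exact: wG.
rewrite !expr2 -[X in (_ + X)%E](qE d)// -integralD//=.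
pose Q x : R := s * m x * G x ^+ 2 + q x.
pose P x : R := Num.max 0 (Q x).
have mQ : measurable_fun `[c, d] Q.
  apply: measurable_funD.
  - by case/integrableP : imG => /measurable_EFinP.
  - by case/integrableP : iqcd => /measurable_EFinP.
apply: (@le_trans _ _ (\int[lebesgue_measure]_(x in `[c, d]) (P x)%:E)%E).
  apply: le_integral => //.
  - exact: integrableD.
  - rewrite (_ : (fun x => _) = (EFin \o Q)^\+%E).
      apply: integrable_funepos => //.
      by rewrite (_ : _ \o _ = (EFin \o (fun x => (s * m x * G x ^+ 2)%R)) \+ (EFin \o q))%E//; exact: integrableD.
    by apply/funext => x; rewrite funeposE/= -EFin_max /P maxC.
  - by move=> x _; rewrite -EFinD lee_fin /P le_max lexx orbT.
apply: ge0_le_integral_ae => //.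
- apply/measurable_EFinP; exact: measurable_maxr.
- by move=> x _; rewrite lee_fin /P le_max lexx.
- move=> x; rewrite /= in_itv/= => /andP[cx xd].
  by rewrite lee_fin divr_ge0 ?sqr_ge0// ltW// n0.
have := lebesgue_ae_and (ae_neq c) (lebesgue_ae_and (ae_neq d) (lebesgue_ae_and Gk Pq)).
apply: lebesgue_ae_imply => x [xc [xd [Gx Px]]]; rewrite /= in_itv/= => /andP[cx xd'].
have {}cx : c < x by rewrite lt_neqAle eq_sym xc.
have {xd}xd : x < d by rewrite lt_neqAle xd.
have {}Gx := Gx cx xd; have {}Px := Px cx xd.
have nx := n0 x (ltW cx) (ltW xd).
have qE' : q x = (k x * G x + G x * k x) * w x + G x * G x * dw x.
  have wx := wdw x (ltW cx) (ltW xd).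
  rewrite (is_derive1_unique Px (is_deriveM (is_deriveM Gx Gx) wx)).
  rewrite -[LHS]/(G x * G x * dw x + w x * (G x * k x + G x * k x)).
  by ring.
rewrite lee_fin /P /Q ge_max divr_ge0 ?sqr_ge0 ?(ltW nx)//=.
rewrite ler_pdivlMr// qE'.
have h1 : G x ^+ 2 * n x * (dw x + n x * w x ^+ 2 + s * m x) <= 0.
  by rewrite mulr_ge0_le0 ?ric// mulr_ge0 ?sqr_ge0// ltW.
have h2 : 0 <= (k x - G x * n x * w x) ^+ 2 by exact: sqr_ge0.
lra.
Qed.

(** * Weights on an open interval *)

Lemma open_oitv (R : realType) (l r : \bar R) : open (oitv l r).
Proof. exact: openI (open_ereal_gt (y:=l)) (open_ereal_lt (y:=r)). Qed.

Lemma measurable_oitv (R : realType) (l r : \bar R) :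
  measurable (oitv l r : set (measurableTypeR R)).
Proof. by apply: open_measurable; exact: open_oitv. Qed.

Lemma is_interval_oitv (R : realType) (l r : \bar R) : is_interval (oitv l r).
Proof.
move=> x y [lx xr] [ly yr] z /andP[xz zy]; split.
- by apply: lt_le_trans lx _; rewrite lee_fin.
- by apply: le_lt_trans yr; rewrite lee_fin.
Qed.

Lemma oitv_left (R : realType) (l r : \bar R) (z : R) : oitv l r z ->
  oitv l z%:E `<=` oitv l r.
Proof. by move=> [lz zr] x [lx xz]; split => //; exact: lt_trans zr. Qed.

Lemma oitv_right (R : realType) (l r : \bar R) (z : R) : oitv l r z ->
  oitv z%:E r `<=` oitv l r.
Proof. by move=> [lz zr] x [zx xr]; split => //; exact: lt_trans zx. Qed.

Lemma itvcc_oitv (R : realType) (l r : \bar R) (x y : R) : oitv l r x -> oitv l r y ->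
  `[x, y]%classic `<=` oitv l r.
Proof. by move=> lx ly z /=; rewrite in_itv/=; exact: is_interval_oitv. Qed.

Lemma continuous_on_measurable (R : realType) (I E : set R) (f : R -> R) :
  open I -> continuous_on I f -> measurable (E : set (measurableTypeR R)) ->
  E `<=` I -> measurable_fun E f.
Proof.
move=> oI cf mE EI; apply: (measurable_funS _ EI); first exact: open_measurable.
by apply: open_continuous_measurable_fun => // x /[!inE]; exact: cf.
Qed.

Lemma continuous_onM (R : realType) (I : set R) (f g : R -> R) :
  continuous_on I f -> continuous_on I g -> continuous_on I (fun x => f x * g x).
Proof. by move=> cf cg x Ix; apply: continuousM; [exact: cf|exact: cg]. Qed.

Lemma continuous_onN (R : realType) (I : set R) (f : R -> R) :
  continuous_on I f -> continuous_on I (fun x => - f x).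
Proof. by move=> cf x Ix; apply: continuousN; exact: cf. Qed.

(** The set functions [mu] and [nu] are, by conversion, the cases
    [m = e^C / a] and [m = e^-C]. *)
Definition weighted (R : realType) (I : set R) (m : R -> R)
    (A : set (measurableTypeR R)) : \bar R :=
  (\int[lebesgue_measure]_(x in A `&` I) (m x)%:E)%E.

Lemma weightedE (R : realType) (I : set R) (m : R -> R) :
  weighted I m = with_density (@lebesgue_measure R) (m \_ I).
Proof.
apply/funext => A; rewrite /weighted /with_density integral_mkcondr.
by apply: eq_integral => x _; rewrite !patchE; case: ifP.
Qed.

Lemma integral_weighted (R : realType) (I E : set R) (m : R -> R) (g : R -> \bar R) :
  open I -> continuous_on I m -> (forall x, I x -> 0 <= m x) ->
  measurable (E : set (measurableTypeR R)) -> E `<=` I ->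
  (forall x, E x -> 0 <= g x)%E -> measurable_fun (E : set (measurableTypeR R)) g ->
  (\int[weighted I m]_(x in E) g x = \int[lebesgue_measure]_(x in E) (g x * (m x)%:E))%E.
Proof.
move=> oI cm m0 mE EI g0 mg; have mI := open_measurable oI.
rewrite weightedE integral_with_density//.
- by apply: eq_integral => x /[!inE] Ex; rewrite patchE mem_set//; exact: EI.
- by apply: (measurable_restrictT _ mI).1; apply: (continuous_on_measurable oI).
- by move=> x; rewrite patchE; case: ifPn => // /[!inE]; exact: m0.
Qed.

Lemma weighted_sub (R : realType) (I E : set R) (m : R -> R) : E `<=` I ->
  weighted I m E = (\int[lebesgue_measure]_(x in E) (m x)%:E)%E.
Proof. by move=> EI; rewrite /weighted setIidl. Qed.

Lemma integral_itvE (R : realType) (I : set R) (g : R -> R) (t x y : R) :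
  is_interval I -> continuous_on I g -> I t -> I x -> I y -> x <= y ->
  (\int[lebesgue_measure]_(u in `[x, y]) (g u)%:E =
   (primitive g t y - primitive g t x)%:E)%E.
Proof.
move=> iI cg It Ix Iy xy; rewrite (primitiveB iI cg It Ix Iy xy) /Rintegral fineK//.
by apply: integrable_fin_num => //; exact: continuous_on_integrable cg Ix Iy.
Qed.

Lemma primitive_lt (R : realType) (I : set R) (g : R -> R) (t x y : R) :
  open I -> is_interval I -> continuous_on I g -> (forall x, I x -> 0 < g x) ->
  I t -> I x -> I y -> x < y -> primitive g t x < primitive g t y.
Proof.
move=> oI iI cg g0 It Ix Iy xy.
have Isub z : x <= z -> z <= y -> I z by move=> xz zy; apply: (iI x y) => //; rewrite xz.
have [||z] := @MVT R (primitive g t) g x y xy.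
- move=> z; rewrite in_itv/= => /andP[xz zy].
  by apply: (is_derive_primitive oI iI cg It); apply: Isub; exact: ltW.
- apply: continuous_in_subspaceT => z; rewrite inE/= in_itv/= => /andP[xz zy].
  by apply: is_derive1_continuous; apply: (is_derive_primitive oI iI cg It); exact: Isub.
rewrite in_itv/= => /andP[xz zy] E; rewrite -subr_gt0 E mulr_gt0 ?subr_gt0//.
by apply/g0/Isub; exact: ltW.
Qed.

Lemma continuous_on_primitive (R : realType) (I : set R) (g : R -> R) (t : R) :
  open I -> is_interval I -> continuous_on I g -> I t -> continuous_on I (primitive g t).
Proof.
by move=> oI iI cg It x Ix; apply: is_derive1_continuous; exact: (is_derive_primitive oI iI cg It).
Qed.

Lemma oitv_lt_left (R : realType) (l r : \bar R) (t : R) : oitv l r t ->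
  exists2 z, oitv l r z & z < t.
Proof.
move=> It; have /nbhs_ballP [e /= e0 He] := open_nbhs_nbhs (conj (@open_oitv R l r) It).
exists (t - e / 2); last by lra.
by apply: He; rewrite /ball/= opprD addrA subrr add0r opprK gtr0_norm; lra.
Qed.

Lemma oitv_lt_right (R : realType) (l r : \bar R) (t : R) : oitv l r t ->
  exists2 z, oitv l r z & t < z.
Proof.
move=> It; have /nbhs_ballP [e /= e0 He] := open_nbhs_nbhs (conj (@open_oitv R l r) It).
exists (t + e / 2); last by lra.
by apply: He; rewrite /ball/= opprD addrA subrr add0r normrN gtr0_norm; lra.
Qed.

Lemma integral_oitv_split_left (R : realType) (l : \bar R) (z t : R) (g : R -> \bar R) :
  (l < z%:E)%E -> z <= t ->  measurable_fun (oitv l t%:E : set (measurableTypeR R)) g ->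
  measurable_fun (`[z, t]%classic : set (measurableTypeR R)) g ->
  (\int[lebesgue_measure]_(x in oitv l t%:E) g x =
   \int[lebesgue_measure]_(x in oitv l z%:E) g x +
   \int[lebesgue_measure]_(x in `[z, t]) g x)%E.
Proof.
move=> lz zt mg mgt.
have E : oitv l t%:E = oitv l z%:E `|` `[z, t[%classic.
  apply/seteqP; split => x /=; rewrite in_itv/= /oitv/= !lte_fin.
    by move=> [lx xt]; have [xz|zx] := ltP x z; [left|right; rewrite xt].
  move=> [[lx xz]|/andP[zx xt]]; split => //; first exact: lt_le_trans zt.
  by apply: (lt_le_trans lz); rewrite lee_fin.
rewrite -integral_itv_bndo_bndc; last first.
  by apply: measurable_funS mgt => //; exact: subset_itv_co_cc.
rewrite E integral_setU// -?E//; first exact: measurable_oitv.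
apply/disj_set2P/seteqP; split => // x /= [[_ xz]]; rewrite in_itv/= => /andP[zx _].
by move: xz; rewrite lte_fin ltNge zx.
Qed.

Lemma integral_oitv_split_right (R : realType) (r : \bar R) (t z : R) (g : R -> \bar R) :
  (z%:E < r)%E -> t <= z ->  measurable_fun (oitv t%:E r : set (measurableTypeR R)) g ->
  measurable_fun (`[t, z]%classic : set (measurableTypeR R)) g ->
  (\int[lebesgue_measure]_(x in oitv t%:E r) g x =
   \int[lebesgue_measure]_(x in oitv z%:E r) g x +
   \int[lebesgue_measure]_(x in `[t, z]) g x)%E.
Proof.
move=> zr tz mg mgt.
have E : oitv t%:E r = oitv z%:E r `|` `]t, z]%classic.
  apply/seteqP; split => x /=; rewrite in_itv/= /oitv/= !lte_fin.
    by move=> [tx xr]; have [xz|zx] := leP x z; [right; rewrite tx|left].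
  move=> [[zx xr]|/andP[tx xz]]; split => //; first exact: le_lt_trans zx.
  by apply: le_lt_trans zr; rewrite lee_fin.
rewrite -integral_itv_obnd_cbnd; last first.
  by apply: measurable_funS mgt => //; exact: subset_itv_oc_cc.
rewrite E integral_setU// -?E//; first exact: measurable_oitv.
apply/disj_set2P/seteqP; split => // x /= [[zx _]]; rewrite in_itv/= => /andP[_ xz].
by move: zx; rewrite lte_fin ltNge xz.
Qed.

Lemma Rintegral_oitv_left (R : realType) (l r : \bar R) (g : R -> R) (s t : R) :
  let I := oitv l r in
  continuous_on I g -> (@lebesgue_measure R).-integrable I (EFin \o g) ->
  I s -> I t ->
  \int[lebesgue_measure]_(x in oitv l s%:E) g x =
  \int[lebesgue_measure]_(x in oitv l t%:E) g x + primitive g t s.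
Proof.
move=> I cg ig Is It.
have oI : open I by exact: open_oitv.
have iI : is_interval I by exact: is_interval_oitv.
suff H x y : I x -> I y -> x <= y ->
    \int[lebesgue_measure]_(x in oitv l y%:E) g x =
    \int[lebesgue_measure]_(x in oitv l x%:E) g x + (primitive g t y - primitive g t x).
  have pt := primitive_refl g t.
  have [st|ts] := leP s t; first by rewrite (H s t Is It st) pt; ring.
  by rewrite (H t s It Is (ltW ts)) pt; ring.
move=> Ix Iy xy; have fin z : I z -> (\int[lebesgue_measure]_(x in oitv l z%:E) (g x)%:E \is a fin_num)%E.
  move=> Iz; apply: integrable_fin_num => //; first exact: measurable_oitv.
  apply: integrableS ig => //; [exact: measurable_oitv|exact: measurable_oitv|exact: oitv_left].
rewrite /Rintegral (@integral_oitv_split_left _ _ x)//; last 3 first.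
- by have [] := Ix.
- apply/measurable_EFinP; apply: (continuous_on_measurable oI) => //; first exact: measurable_oitv.
  exact: oitv_left.
- by apply/measurable_EFinP; apply: (continuous_on_measurable oI) => //; exact: itvcc_oitv.
by rewrite (integral_itvE iI cg It Ix Iy xy) fineD// fin.
Qed.

Lemma Rintegral_oitv_right (R : realType) (l r : \bar R) (g : R -> R) (s t : R) :
  let I := oitv l r in
  continuous_on I g -> (@lebesgue_measure R).-integrable I (EFin \o g) ->
  I s -> I t ->
  \int[lebesgue_measure]_(x in oitv s%:E r) g x =
  \int[lebesgue_measure]_(x in oitv t%:E r) g x - primitive g t s.
Proof.
move=> I cg ig Is It.
have oI : open I by exact: open_oitv.
have iI : is_interval I by exact: is_interval_oitv.
suff H x y : I x -> I y -> x <= y ->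
    \int[lebesgue_measure]_(x in oitv x%:E r) g x =
    \int[lebesgue_measure]_(x in oitv y%:E r) g x + (primitive g t y - primitive g t x).
  have pt := primitive_refl g t.
  have [st|ts] := leP s t; first by rewrite (H s t Is It st) pt; ring.
  by rewrite (H t s It Is (ltW ts)) pt; ring.
move=> Ix Iy xy; have fin z : I z -> (\int[lebesgue_measure]_(x in oitv z%:E r) (g x)%:E \is a fin_num)%E.
  move=> Iz; apply: integrable_fin_num => //; first exact: measurable_oitv.
  apply: integrableS ig => //; [exact: measurable_oitv|exact: measurable_oitv|exact: oitv_right].
rewrite /Rintegral (@integral_oitv_split_right _ _ _ y)//; last 3 first.
- by have [] := Iy.
- apply/measurable_EFinP; apply: (continuous_on_measurable oI) => //; first exact: measurable_oitv.
  exact: oitv_right.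
- by apply/measurable_EFinP; apply: (continuous_on_measurable oI) => //; exact: itvcc_oitv.
by rewrite (integral_itvE iI cg It Ix Iy xy) fineD// fin.
Qed.

Lemma eq_integral_setfun d (T : measurableType d) (R : realType)
  (m : set T -> \bar R) (D : set T) (f g : T -> \bar R) :
  (forall x, D x -> f x = g x) -> (\int[m]_(x in D) f x = \int[m]_(x in D) g x)%E.
Proof.
move=> fg; rewrite /integral; suff -> : f \_ D = g \_ D by [].
by apply/funext => x; rewrite !patchE; case: ifPn => // /[!inE]; exact: fg.
Qed.

Lemma integral_weighted_itv (R : realType) (I : set R) (m f : R -> R) (t x y : R) :
  open I -> is_interval I -> continuous_on I m -> continuous_on I f ->
  (forall x, I x -> 0 < m x) -> (forall x, I x -> 0 < f x) ->
  I t -> I x -> I y -> x <= y ->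
  (\int[weighted I m]_(u in `[x, y]) (f u)%:E =
   (primitive (fun u => f u * m u) t y - primitive (fun u => f u * m u) t x)%:E)%E.
Proof.
move=> oI iI cm cf m0 f0 It Ix Iy xy.
have xyI : `[x, y]%classic `<=` I by move=> z /=; rewrite in_itv/=; exact: iI.
rewrite integral_weighted//.
- under eq_integral do rewrite -EFinM.
  by apply: (integral_itvE iI) => //; exact: continuous_onM.
- by move=> u Iu; rewrite ltW// m0.
- by move=> u /xyI Iu; rewrite lee_fin ltW// f0.
- by apply/measurable_EFinP; apply: (continuous_on_measurable oI).
Qed.

Lemma weighted_gt0 (R : realType) (I E : set R) (n : R -> R) (x y : R) :
  open I -> is_interval I -> continuous_on I n -> (forall x, I x -> 0 < n x) ->
  measurable (E : set (measurableTypeR R)) ->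
  E `<=` I -> I x -> I y -> x < y -> `[x, y]%classic `<=` E -> (0 < weighted I n E)%E.
Proof.
move=> oI iI cn n0 mE EI Ix Iy xy xyE; rewrite weighted_sub//.
apply: (@lt_le_trans _ _ (\int[lebesgue_measure]_(u in `[x, y]) (n u)%:E)%E).
  by rewrite (integral_itvE iI cn Ix Ix Iy (ltW xy)) lte_fin subr_gt0 (primitive_lt oI iI).
apply: ge0_subset_integral => //.
- by apply/measurable_EFinP; apply: (continuous_on_measurable oI).
- by move=> u /EI Iu; rewrite lee_fin ltW// n0.
Qed.

Lemma weighted_le_integral (R : realType) (I E : set R) (n g : R -> R) (c : R) :
  open I -> continuous_on I n -> (forall x, I x -> 0 < n x) -> continuous_on I g ->
  measurable (E : set (measurableTypeR R)) -> E `<=` I ->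
  0 <= c -> (forall x, E x -> c <= g x) ->
  (c%:E * weighted I n E <= \int[weighted I n]_(x in E) (g x)%:E)%E.
Proof.
move=> oI cn n0 cg mE EI c0 cgE; have mn := continuous_on_measurable oI cn mE EI.
have mg := continuous_on_measurable oI cg mE EI.
have n0' u : E u -> 0 <= n u by move=> /EI Iu; rewrite ltW// n0.
rewrite weighted_sub// integral_weighted//; last 3 first.
- by move=> u Iu; rewrite ltW// n0.
- by move=> u Eu; rewrite lee_fin (le_trans c0)// cgE.
- exact/measurable_EFinP.
rewrite -ge0_integralZl//; last exact/measurable_EFinP.
apply: ge0_le_integral => //.
- by move=> u Eu; rewrite mule_ge0 ?lee_fin// n0'.
- by apply: emeasurable_funM => //; apply/measurable_EFinP.
- by apply: emeasurable_funM => //; apply/measurable_EFinP.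
- by move=> u Eu; rewrite -!EFinM lee_fin ler_wpM2r ?n0'// cgE.
Qed.

Lemma weighted_integrable (R : realType) (I : set R) (n : R -> R) :
  open I -> continuous_on I n -> (forall x, I x -> 0 < n x) ->
  (weighted I n I < +oo)%E -> (@lebesgue_measure R).-integrable I (EFin \o n).
Proof.
move=> oI cn n0; rewrite weighted_sub// => nfin; apply/integrableP; split.
  by apply/measurable_EFinP; apply: (continuous_on_measurable oI) => //; exact: open_measurable.
rewrite (_ : integral _ _ _ = \int[lebesgue_measure]_(x in I) (n x)%:E)%E//.
by apply: eq_integral => x /[!inE] Ix; rewrite /= gtr0_norm// n0.
Qed.

(** * The potentials of a test function *)

(** On the left of [t], [h] is the function [h^-].  It is written as a constant
    plus a primitive, and so is differentiable on both sides of [t].  As [- p]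
    is nonincreasing, [- p z] bounds the inner integral from below over the
    whole of [(l, z)]; this gives the positivity of [h], and the last clause,
    on which the control of boundary terms rests. *)
Lemma left_potential (R : realType) (l r : \bar R) (m n f : R -> R) (t K : R) :
  let I := oitv l r in
  let p := primitive (fun u => f u * m u) t in
  let hm z := (\int[weighted I n]_(x in oitv l z%:E)
    \int[weighted I m]_(u in `[x, t]) (f u)%:E)%E in
  continuous_on I m -> continuous_on I n -> continuous_on I f ->
  (forall x, I x -> 0 < m x) -> (forall x, I x -> 0 < n x) -> (forall x, I x -> 0 < f x) ->
  I t -> (hm t < +oo)%E -> (forall z, I z -> z < t -> (hm z <= (K * f z)%:E)%E) ->
  exists h : R -> R, [/\
    forall z, I z -> is_derive z 1 h (- p z * n z),
    0 < h t,
    forall z, I z -> z < t -> 0 < h z /\ h z <= K * f z &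
    forall z, I z -> z < t -> ((- p z)%:E * weighted I n (oitv l z%:E) <= (h z)%:E)%E].
Proof.
move=> I p hm cm cn cf m0 n0 f0 It hmt hK.
have oI : open I by exact: open_oitv.
have iI : is_interval I by exact: is_interval_oitv.
have cfm : continuous_on I (fun u => f u * m u) by exact: continuous_onM.
have fm0 x : I x -> 0 < f x * m x by move=> Ix; rewrite mulr_gt0 ?f0 ?m0.
have cp : continuous_on I p by exact: continuous_on_primitive.
have pt : p t = 0 by exact: primitive_refl.
have plt x y : I x -> I y -> x < y -> p x < p y by exact: primitive_lt.
have ple x y : I x -> I y -> x <= y -> p x <= p y.
  by move=> Ix Iy; rewrite le_eqVlt => /predU1P[->//|xy]; exact/ltW/plt.
have cpN : continuous_on I (fun u => - p u) by exact: continuous_onN.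
pose g u : R := - p u * n u.
have cg : continuous_on I g by exact: continuous_onM.
have zsub z : I z -> oitv l z%:E `<=` I by exact: oitv_left.
have pN0 z x : I z -> z <= t -> oitv l z%:E x -> 0 <= - p x.
  move=> Iz zt lxz; have Ix := zsub z Iz _ lxz; have [_ xz] := lxz.
  by rewrite oppr_ge0 -pt ple// (le_trans _ zt)// ltW// -lte_fin.
have hmE z : I z -> z <= t ->
    hm z = (\int[weighted I n]_(x in oitv l z%:E) (- p x)%:E)%E.
  move=> Iz zt; apply: eq_integral_setfun => x lxz.
  have Ix := zsub z Iz _ lxz; have [_ xz] := lxz.
  rewrite (@integral_weighted_itv _ _ _ _ t) ?(le_trans _ zt)//; last by rewrite ltW// -lte_fin.
  by rewrite -/p pt sub0r.
have hmE' z : I z -> z <= t ->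
    hm z = (\int[lebesgue_measure]_(x in oitv l z%:E) (g x)%:E)%E.
  move=> Iz zt; rewrite hmE// integral_weighted//.
  - by move=> u Iu; rewrite ltW// n0.
  - exact: measurable_oitv.
  - exact: zsub.
  - by move=> u lu; rewrite lee_fin (pN0 z).
  - apply/measurable_EFinP; apply: (continuous_on_measurable oI) => //; last exact: zsub.
    exact: measurable_oitv.
pose P := primitive g t.
have Pt : P t = 0 by exact: primitive_refl.
have hm0 z : I z -> z <= t -> (0 <= hm z)%E.
  move=> Iz zt; rewrite hmE'//; apply: integral_ge0 => u lu.
  rewrite lee_fin mulr_ge0 ?(pN0 z)//; apply/ltW/n0; exact: zsub lu.
have hmD z : I z -> z <= t -> (hm t = hm z + (- P z)%:E)%E.
  move=> Iz zt; rewrite !hmE'// (@integral_oitv_split_left _ _ z)//.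
  - by rewrite (integral_itvE iI cg It Iz It zt) -/P Pt sub0r.
  - by have [] := Iz.
  - apply/measurable_EFinP; apply: (continuous_on_measurable oI) => //; last exact: zsub.
    exact: measurable_oitv.
  - by apply/measurable_EFinP; apply: (continuous_on_measurable oI) => //; exact: itvcc_oitv.
have hmtfin : hm t \is a fin_num by rewrite ge0_fin_numE// hm0.
exists (fun z => fine (hm t) + P z).
have hE z : I z -> z <= t -> (fine (hm t) + P z)%:E = hm z.
  move=> Iz zt; rewrite EFinD fineK// (hmD z)// -addeA -EFinD addNr adde0//.
have lowN z : I z -> z < t -> ((- p z)%:E * weighted I n (oitv l z%:E) <= hm z)%E.
  move=> Iz zt; rewrite (hmE z Iz (ltW zt)).
  apply: (@weighted_le_integral _ I _ n (fun x => - p x) (- p z)) => //.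
  - exact: measurable_oitv.
  - exact: zsub.
  - by rewrite oppr_ge0 -pt ple// ltW.
  - move=> x lx; rewrite lerN2 ple//; first exact: zsub lx.
    by have [_] := lx; rewrite lte_fin => /ltW.
have hpos z : I z -> z < t -> (0 < hm z)%E.
  move=> Iz zt; apply: lt_le_trans (lowN z Iz zt); apply: mule_gt0.
    by rewrite lte_fin oppr_gt0 -pt plt.
  have [z' Iz' z'z] := oitv_lt_left Iz; have [z'' Iz'' z''z'] := oitv_lt_left Iz'.
  apply: (@weighted_gt0 _ _ _ _ z'' z') => //; first exact: measurable_oitv.
    exact: zsub.
  move=> u /=; rewrite in_itv/= => /andP[z''u uz']; split.
    by have [lz _] := Iz''; apply: (lt_le_trans lz); rewrite lee_fin.
  by rewrite lte_fin (le_lt_trans uz').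
split.
- move=> z Iz; have dP := is_derive_primitive oI iI cg It Iz.
  by have := is_deriveD (is_derive_cst (fine (hm t)) z 1) dP; rewrite add0r.
- have [z Iz zt] := oitv_lt_left It; rewrite -lte_fin hE//.
  rewrite (hmD z Iz (ltW zt)) (lt_le_trans (hpos z Iz zt))// leeDl//.
  rewrite -[- P z]sub0r -Pt -(integral_itvE iI cg It Iz It (ltW zt)).
  apply: integral_ge0 => u zut; have Iu := itvcc_oitv Iz It zut.
  move: zut; rewrite /= in_itv/= => /andP[zu ut].
  by rewrite lee_fin mulr_ge0 ?(ltW (n0 u Iu))// oppr_ge0 -pt ple.
- by move=> z Iz zt; rewrite -lte_fin -lee_fin (hE z Iz (ltW zt)); split; [exact: hpos|exact: hK].
- by move=> z Iz zt; rewrite (hE z Iz (ltW zt)); exact: lowN.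
Qed.

(** The mirror image of [left_potential]. *)
Lemma right_potential (R : realType) (l r : \bar R) (m n f : R -> R) (t K : R) :
  let I := oitv l r in
  let p := primitive (fun u => f u * m u) t in
  let hp z := (\int[weighted I n]_(x in oitv z%:E r)
    \int[weighted I m]_(u in `[t, x]) (f u)%:E)%E in
  continuous_on I m -> continuous_on I n -> continuous_on I f ->
  (forall x, I x -> 0 < m x) -> (forall x, I x -> 0 < n x) -> (forall x, I x -> 0 < f x) ->
  I t -> (hp t < +oo)%E -> (forall z, I z -> t < z -> (hp z <= (K * f z)%:E)%E) ->
  exists h : R -> R, [/\
    forall z, I z -> is_derive z 1 h (- p z * n z),
    0 < h t,
    forall z, I z -> t < z -> 0 < h z /\ h z <= K * f z &
    forall z, I z -> t < z -> ((p z)%:E * weighted I n (oitv z%:E r) <= (h z)%:E)%E].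
Proof.
move=> I p hp cm cn cf m0 n0 f0 It hpt hK.
have oI : open I by exact: open_oitv.
have iI : is_interval I by exact: is_interval_oitv.
have cfm : continuous_on I (fun u => f u * m u) by exact: continuous_onM.
have fm0 x : I x -> 0 < f x * m x by move=> Ix; rewrite mulr_gt0 ?f0 ?m0.
have cp : continuous_on I p by exact: continuous_on_primitive.
have pt : p t = 0 by exact: primitive_refl.
have plt x y : I x -> I y -> x < y -> p x < p y by exact: primitive_lt.
have ple x y : I x -> I y -> x <= y -> p x <= p y.
  by move=> Ix Iy; rewrite le_eqVlt => /predU1P[->//|xy]; exact/ltW/plt.
pose g u : R := p u * n u.
have cg : continuous_on I g by exact: continuous_onM.
have zsub z : I z -> oitv z%:E r `<=` I by exact: oitv_right.
have p0 z x : I z -> t <= z -> oitv z%:E r x -> 0 <= p x.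
  move=> Iz tz lxz; have Ix := zsub z Iz _ lxz; have [zx _] := lxz.
  by rewrite -pt ple// (le_trans tz)// ltW// -lte_fin.
have hpE z : I z -> t <= z ->
    hp z = (\int[weighted I n]_(x in oitv z%:E r) (p x)%:E)%E.
  move=> Iz tz; apply: eq_integral_setfun => x lxz.
  have Ix := zsub z Iz _ lxz; have [zx _] := lxz.
  rewrite (@integral_weighted_itv _ _ _ _ t) ?(le_trans tz)//; last by rewrite ltW// -lte_fin.
  by rewrite -/p pt subr0.
have hpE' z : I z -> t <= z ->
    hp z = (\int[lebesgue_measure]_(x in oitv z%:E r) (g x)%:E)%E.
  move=> Iz tz; rewrite hpE// integral_weighted//.
  - by move=> u Iu; rewrite ltW// n0.
  - exact: measurable_oitv.
  - exact: zsub.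
  - by move=> u lu; rewrite lee_fin (p0 z).
  - apply/measurable_EFinP; apply: (continuous_on_measurable oI) => //; last exact: zsub.
    exact: measurable_oitv.
pose P := primitive g t.
have Pt : P t = 0 by exact: primitive_refl.
have hp0 z : I z -> t <= z -> (0 <= hp z)%E.
  move=> Iz tz; rewrite hpE'//; apply: integral_ge0 => u lu.
  rewrite lee_fin mulr_ge0 ?(p0 z)//; apply/ltW/n0; exact: zsub lu.
have hpD z : I z -> t <= z -> (hp t = hp z + (P z)%:E)%E.
  move=> Iz tz; rewrite !hpE'// (@integral_oitv_split_right _ _ _ z)//.
  - by rewrite (integral_itvE iI cg It It Iz tz) -/P Pt subr0.
  - by have [] := Iz.
  - apply/measurable_EFinP; apply: (continuous_on_measurable oI) => //; last exact: zsub.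
    exact: measurable_oitv.
  - by apply/measurable_EFinP; apply: (continuous_on_measurable oI) => //; exact: itvcc_oitv.
have hptfin : hp t \is a fin_num by rewrite ge0_fin_numE// hp0.
exists (fun z => fine (hp t) - P z).
have hE z : I z -> t <= z -> (fine (hp t) - P z)%:E = hp z.
  move=> Iz tz; rewrite EFinD fineK// (hpD z)// -addeA -EFinD subrr adde0//.
have lowp z : I z -> t < z -> ((p z)%:E * weighted I n (oitv z%:E r) <= hp z)%E.
  move=> Iz tz; rewrite (hpE z Iz (ltW tz)).
  apply: (@weighted_le_integral _ I _ n p (p z)) => //.
  - exact: measurable_oitv.
  - exact: zsub.
  - by rewrite -pt ple// ltW.
  - move=> x lx; rewrite ple//; first exact: zsub lx.
    by have [+ _] := lx; rewrite lte_fin => /ltW.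
have hpos z : I z -> t < z -> (0 < hp z)%E.
  move=> Iz tz; apply: lt_le_trans (lowp z Iz tz); apply: mule_gt0.
    by rewrite lte_fin -pt plt.
  have [z' Iz' zz'] := oitv_lt_right Iz; have [z'' Iz'' z'z''] := oitv_lt_right Iz'.
  apply: (@weighted_gt0 _ _ _ _ z' z'') => //; first exact: measurable_oitv.
    exact: zsub.
  move=> u /=; rewrite in_itv/= => /andP[z'u uz'']; split.
    by rewrite lte_fin (lt_le_trans zz').
  by have [_ zr] := Iz''; apply: le_lt_trans zr; rewrite lee_fin.
split.
- move=> z Iz; have dP := is_derive_primitive oI iI cg It Iz.
  by have := is_deriveB (is_derive_cst (fine (hp t)) z 1) dP; rewrite sub0r mulNr.
- have [z Iz tz] := oitv_lt_right It; rewrite -lte_fin hE//.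
  rewrite (hpD z Iz (ltW tz)) (lt_le_trans (hpos z Iz tz))// leeDl//.
  rewrite -[P z]subr0 -Pt -(integral_itvE iI cg It It Iz (ltW tz)).
  apply: integral_ge0 => u tzu; have Iu := itvcc_oitv It Iz tzu.
  move: tzu; rewrite /= in_itv/= => /andP[tu uz].
  by rewrite lee_fin mulr_ge0 ?(ltW (n0 u Iu))// -pt ple.
- by move=> z Iz tz; rewrite -lte_fin -lee_fin (hE z Iz (ltW tz)); split; [exact: hpos|exact: hK].
- by move=> z Iz tz; rewrite (hE z Iz (ltW tz)); exact: lowp.
Qed.

(** The quotient [w = - p / h] satisfies [w' = - f m / h - n w^2], and
    [h <= K f] makes it a Riccati supersolution for [s = 1 / K]. *)
Lemma quotient_energy_bound (R : realType) (I : set R) (c d K : R) (m n f p h G k : R -> R) :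
  is_interval I -> I c -> I d -> c <= d -> 0 < K ->
  continuous_on I m -> continuous_on I n -> continuous_on I f ->
  (forall x, I x -> 0 < m x) -> (forall x, I x -> 0 < n x) -> (forall x, I x -> 0 < f x) ->
  (forall x, I x -> is_derive x 1 p (f x * m x)) ->
  (forall x, I x -> is_derive x 1 h (- p x * n x)) ->
  (forall x, c <= x -> x <= d -> 0 < h x) ->
  (forall x, c < x -> x < d -> h x <= K * f x) ->
  abs_continuous_on c d G ->
  {ae lebesgue_measure, forall x, c < x -> x < d -> is_derive x 1 G (k x)} ->
  (\int[lebesgue_measure]_(x in `[c, d]) (K^-1 * m x * G x ^+ 2)%:E +
     (G d ^+ 2 * (- p d / h d) - G c ^+ 2 * (- p c / h c))%:E <=
   \int[lebesgue_measure]_(x in `[c, d]) (k x ^+ 2 / n x)%:E)%E.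
Proof.
move=> iI Ic Id cd K0 cm cn cf m0 n0 f0 dp dh h0 hK acG Gk.
have Isub x : c <= x -> x <= d -> I x by move=> cx xd; apply: (iI c d) => //; rewrite cx.
pose dw x : R := - (f x * m x) * (h x)^-1 - n x * ((p x * (h x)^-1) ^+ 2).
apply: (@riccati_energy_bound _ c d K^-1 m n (fun x => - p x / h x) dw) => //.
- by rewrite invr_ge0 ltW.
- by move=> x cx xd; exact/cm/Isub.
- by move=> x cx xd; exact/n0/Isub.
- move=> x cx xd; have hx : h x != 0 by rewrite gt_eqF// h0.
  have Ix := Isub x cx xd.
  have := is_deriveM (is_deriveN (dp x Ix)) (is_deriveV hx (dh x Ix)).
  set D := (X in is_derive x 1 _ X); rewrite (_ : dw x = D)//.
  rewrite /D -[RHS]/(- p x * (- (h x ^- 2) * (- p x * n x)) + (h x)^-1 * (- (f x * m x))) /dw.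
  by field.
- move=> x cx xd; have hx : h x != 0 by rewrite gt_eqF// h0.
  have Ix := Isub x cx xd.
  have cp : {for x, continuous p} by apply: is_derive1_continuous; exact: dp.
  have chV : {for x, continuous (fun x => (h x)^-1)}.
    by apply: continuousV => //; apply: is_derive1_continuous; exact: dh.
  apply: continuousB.
    by apply: continuousM => //; apply: continuousN; apply: continuousM; [exact: cf|exact: cm].
  apply: continuousM; first exact: cn.
  by apply: continuousM; exact: continuousM.
- move=> x cx xd; have Ix := Isub x (ltW cx) (ltW xd).
  have hx : 0 < h x by rewrite h0// ltW.
  rewrite (_ : _ + _ + _ = m x * (K^-1 - f x / h x)); last by rewrite /dw; ring.
  rewrite mulr_ge0_le0 ?(ltW (m0 x Ix))// subr_le0 ler_pdivlMr// mulrC ler_pdivrMr//.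
  by rewrite mulrC hK.
Qed.

Lemma ge0_integral_itv_split (R : realType) (c t d : R) (g : R -> \bar R) :
  c <= t -> t <= d -> measurable_fun (`[c, d]%classic : set (measurableTypeR R)) g ->
  (forall x, c <= x -> x <= d -> (0 <= g x)%E) ->
  (\int[lebesgue_measure]_(x in `[c, d]) g x =
   \int[lebesgue_measure]_(x in `[c, t]) g x +
   \int[lebesgue_measure]_(x in `[t, d]) g x)%E.
Proof.
move=> ct td mg g0.
have E : `[c, d]%classic = `[c, t]%classic `|` `]t, d]%classic.
  by rewrite -itv_bndbnd_setU// bnd_simp.
rewrite -[X in (_ + X)%E]integral_itv_obnd_cbnd; last first.
  by apply: measurable_funS mg => //; apply: subset_itv; rewrite bnd_simp.
rewrite {1}E ge0_integral_setU// -?E//.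
- by move=> x /=; rewrite in_itv/= => /andP[]; exact: g0.
- apply/disj_set2P/seteqP; split => // x /=; rewrite !in_itv/= => -[/andP[_ xt] /andP[tx _]].
  by move: tx; rewrite ltNge xt.
Qed.

(** The bounds on [[c, t]] and on [[t, d]] add up with no contribution of [t],
    where [p] vanishes.  The coefficients [a = - p c / h c] and
    [b = p d / h d] of the boundary terms are at most the inverses of the masses
    of the two tails. *)
Lemma potential_energy_bound (R : realType) (l r : \bar R) (m n f : R -> R)
    (t K c d : R) (G k : R -> R) :
  let I := oitv l r in
  continuous_on I m -> continuous_on I n -> continuous_on I f ->
  (forall x, I x -> 0 < m x) -> (forall x, I x -> 0 < n x) -> (forall x, I x -> 0 < f x) ->
  I t ->
  (\int[weighted I n]_(x in oitv l t%:E)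
      \int[weighted I m]_(u in `[x, t]) (f u)%:E < +oo)%E ->
  (\int[weighted I n]_(x in oitv t%:E r)
      \int[weighted I m]_(u in `[t, x]) (f u)%:E < +oo)%E ->
  (forall z, I z -> (z < t)%R -> \int[weighted I n]_(x in oitv l z%:E)
      \int[weighted I m]_(u in `[x, t]) (f u)%:E <= (K * f z)%:E)%E ->
  (forall z, I z -> (t < z)%R -> \int[weighted I n]_(x in oitv z%:E r)
      \int[weighted I m]_(u in `[t, x]) (f u)%:E <= (K * f z)%:E)%E ->
  I c -> I d -> c < t -> t < d ->
  abs_continuous_on c d G ->
  measurable_fun (`[c, d]%classic : set (measurableTypeR R)) k ->
  {ae lebesgue_measure, forall x, c < x -> x < d -> is_derive x 1 G (k x)} ->
  0 < K /\ exists a b : R, [/\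
    0 <= a /\ (a%:E * weighted I n (oitv l c%:E) <= 1)%E,
    0 <= b /\ (b%:E * weighted I n (oitv d%:E r) <= 1)%E &
    (\int[lebesgue_measure]_(x in `[c, d]) (K^-1 * m x * G x ^+ 2)%:E <=
     \int[lebesgue_measure]_(x in `[c, d]) (k x ^+ 2 / n x)%:E +
       (G c ^+ 2 * a + G d ^+ 2 * b)%:E)%E].
Proof.
move=> I cm cn cf m0 n0 f0 It hmt hpt hmK hpK Ic Id ct td acG mk Gk.
have oI : open I by exact: open_oitv.
have iI : is_interval I by exact: is_interval_oitv.
have cfm : continuous_on I (fun u => f u * m u) by exact: continuous_onM.
have fm0 x : I x -> 0 < f x * m x by move=> Ix; rewrite mulr_gt0 ?f0 ?m0.
have [h [dh ht hK hn]] := left_potential cm cn cf m0 n0 f0 It hmt hmK.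
have [h' [dh' ht' hK' hn']] := right_potential cm cn cf m0 n0 f0 It hpt hpK.
set p := primitive (fun u => f u * m u) t in dh dh' hn hn'.
have pt : p t = 0 by exact: primitive_refl.
have dp x : I x -> is_derive x 1 p (f x * m x) by exact: (is_derive_primitive oI iI cfm It).
have Isub x : c <= x -> x <= d -> I x by move=> cx xd; apply: (iI c d) => //; rewrite cx.
have pc : p c < 0 by rewrite -pt; exact: (primitive_lt oI iI cfm fm0 It).
have pd : 0 < p d by rewrite -pt; exact: (primitive_lt oI iI cfm fm0 It).
have [hc hcK] := hK c Ic ct; have [hd hdK] := hK' d Id td.
have K0 : 0 < K by have := lt_le_trans hc hcK; rewrite pmulr_lgt0// f0.
split => //; exists (- p c / h c), (p d / h' d).
have quot (x y : R) (w : \bar R) : 0 < y -> (x%:E * w <= y%:E)%E -> ((x / y)%:E * w <= 1)%E.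
  move=> y0 H; rewrite mulrC EFinM -muleA.
  apply: (@le_trans _ _ ((y^-1)%:E * y%:E)%E).
    by apply: lee_wpmul2l => //; rewrite lee_fin invr_ge0 ltW.
  by rewrite -EFinM mulVf// gt_eqF.
split.
- split; first by rewrite divr_ge0 ?ltW// oppr_gt0.
  by apply: quot => //; exact: hn.
- split; first by rewrite divr_ge0 ?ltW.
  by apply: quot => //; exact: hn'.
have acS x y : c <= x -> y <= d -> abs_continuous_on x y G.
  move=> cx yd e e0; have [delta delta0 H] := acG e e0.
  exists delta => // q ll rr lr; apply: H => i; have [? ? ?] := lr i.
  by split => //; [exact: le_trans cx _|exact: le_trans yd].
have HL := @quotient_energy_bound R I c t K m n f p h G k iI Ic It (ltW ct) K0 cm cn cf
  m0 n0 f0 dp dh.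
have HR := @quotient_energy_bound R I t d K m n f p h' G k iI It Id (ltW td) K0 cm cn cf
  m0 n0 f0 dp dh'.
have {}HL : (\int[lebesgue_measure]_(x in `[c, t]) (K^-1 * m x * G x ^+ 2)%:E +
     (- (G c ^+ 2 * (- p c / h c)))%:E <=
   \int[lebesgue_measure]_(x in `[c, t]) (k x ^+ 2 / n x)%:E)%E.
  have := HL _ _ _ _; rewrite pt oppr0 mul0r mulr0 sub0r; apply.
  - move=> x cx; rewrite le_eqVlt => /predU1P[->//|xt].
    by have [] := hK x (Isub x cx (ltW (lt_trans xt td))) xt.
  - by move=> x cx xt; have [] := hK x (Isub x (ltW cx) (ltW (lt_trans xt td))) xt.
  - by apply: acS => //; exact: ltW.
  - apply: lebesgue_ae_imply Gk => x H cx xt; apply: H => //; exact: lt_trans td.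
have {}HR : (\int[lebesgue_measure]_(x in `[t, d]) (K^-1 * m x * G x ^+ 2)%:E +
     (- (G d ^+ 2 * (p d / h' d)))%:E <=
   \int[lebesgue_measure]_(x in `[t, d]) (k x ^+ 2 / n x)%:E)%E.
  have := HR _ _ _ _; rewrite pt oppr0 mul0r mulr0 subr0 mulNr mulrN; apply.
  - move=> x; rewrite le_eqVlt => /predU1P[<-//|tx] xd.
    by have [] := hK' x (Isub x (ltW (lt_trans ct tx)) xd) tx.
  - by move=> x tx xd; have [] := hK' x (Isub x (ltW (lt_trans ct tx)) (ltW xd)) tx.
  - by apply: acS => //; exact: ltW.
  - apply: lebesgue_ae_imply Gk => x H tx xd; apply: H => //; exact: lt_trans ct _.
have cnV : continuous_on I (fun x => (n x)^-1).
  by move=> x Ix; apply: continuousV; [rewrite gt_eqF// n0|exact: cn].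
have mnV : measurable_fun (`[c, d]%classic : set (measurableTypeR R)) (fun x => (n x)^-1).
  by apply: (continuous_on_measurable oI) => //; exact: itvcc_oitv.
have mm : measurable_fun (`[c, d]%classic : set (measurableTypeR R)) m.
  by apply: (continuous_on_measurable oI) => //; exact: itvcc_oitv.
have mG : measurable_fun (`[c, d]%classic : set (measurableTypeR R)) G.
  apply: subspace_continuous_measurable_fun => //.
  by apply: ac_within_continuous => //; exact: ltW (lt_trans ct td).
rewrite (ge0_integral_itv_split (ltW ct) (ltW td)); last 2 first.
- apply/measurable_EFinP/measurable_funM; first exact: measurable_funM.
  exact: measurable_funX.
- by move=> x cx xd; have mx := ltW (m0 x (Isub x cx xd)); rewrite lee_fin mulr_ge0 ?sqr_ge0// mulr_ge0// invr_ge0 ltW.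
rewrite (ge0_integral_itv_split (ltW ct) (ltW td)); last 2 first.
- by apply/measurable_EFinP/measurable_funM => //; exact: measurable_funX.
- by move=> x cx xd; rewrite lee_fin divr_ge0 ?sqr_ge0//; apply/ltW/n0; exact: Isub.
have sub (x y : \bar R) (u : R) : (x + (- u)%:E <= y -> x <= y + u%:E)%E.
  by rewrite EFinN leeBlDr.
by rewrite EFinD [leRHS]addeACA; exact: leeD (sub _ _ _ HL) (sub _ _ _ HR).
Qed.

(** * The test functions and the constant *)

(** Finiteness of the maximum entails [hfinite f], and bounds [h^-] and [h^+] by
    [K f] on either side of [theta f]. *)
Lemma max_sup_II_bounds (R : realType) (M N : \bar R)
    (mm nn : set (measurableTypeR R) -> \bar R) (f : R -> R) (K : R) :
  (0 < M)%E -> (0 < N)%E ->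
  (forall x, oitv (- M)%E N x -> 0 < f x) ->
  (max_sup_II M N mm nn f <= K%:E)%E ->
  exists t, [/\ oitv (- M)%E N t,
    (hminus M mm nn f t t < +oo)%E /\ (hplus N mm nn f t t < +oo)%E,
    forall z, oitv (- M)%E N z -> z < t -> (hminus M mm nn f t z <= (K * f z)%:E)%E &
    forall z, oitv (- M)%E N z -> t < z -> (hplus N mm nn f t z <= (K * f z)%:E)%E].
Proof.
move=> M0 N0 f0; rewrite /max_sup_II; case: ifPn => [/asboolP hf|_]; last first.
  by rewrite leye_eq.
rewrite ge_max => /andP[supm supp]; set t := theta M N mm nn f in supm supp.
have It : oitv (- M)%E N t.
  (* If no splitting point existed, [theta] would be the default real, [0], which
     lies in the interval because [M] and [N] are positive. *)
  rewrite /t /theta; case: xgetP => [x _ []//|_].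
  by split; [rewrite oppe_lt0|].
have div_le (x : \bar R) (y : R) : 0 < y -> (x / y%:E <= K%:E)%E -> (x <= (K * y)%:E)%E.
  move=> y0; rewrite inver gt_eqF// => H.
  rewrite EFinM -lee_pdivrMr// inver gt_eqF//.
exists t; split => //; first exact: hf.
- move=> z Iz zt; apply: div_le; first exact: f0.
  apply: le_trans supm; apply: ereal_sup_ubound; exists z => //.
  by split; [have [] := Iz|rewrite lte_fin].
- move=> z Iz tz; apply: div_le; first exact: f0.
  apply: le_trans supp; apply: ereal_sup_ubound; exists z => //.
  by split; [rewrite lte_fin|have [] := Iz].
Qed.

(** Both branches of [fxy] are values of a single continuous expression in
    [min s x] and [max s y], because [min s x = x] as soon as [s >= y]. *)
Lemma fxy_continuous_pos (R : realType) (M N : \bar R) (n : R -> R) (x y : R) :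
  let I := oitv (- M)%E N in
  continuous_on I n -> (forall x, I x -> 0 < n x) -> (weighted I n I < +oo)%E ->
  I x -> I y -> x < y ->
  continuous_on I (fxy M N (weighted I n) x y) /\
  forall s, I s -> 0 < fxy M N (weighted I n) x y s.
Proof.
move=> I cn n0 nfin Ix Iy xy.
have oI : open I by exact: open_oitv.
have iI : is_interval I by exact: is_interval_oitv.
have ni := weighted_integrable oI cn n0 nfin.
pose A s := fine (weighted I n (oitv (- M)%E s%:E)).
pose B s := fine (weighted I n (oitv s%:E N)).
have subfin E : measurable (E : set (measurableTypeR R)) -> E `<=` I -> (weighted I n E < +oo)%E.
  move=> mE EI; apply: le_lt_trans nfin; rewrite !weighted_sub//.
  apply: ge0_subset_integral => //; first exact: open_measurable.
    by case/integrableP : ni.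
  by move=> z Iz; rewrite lee_fin ltW// n0.
have AE s : I s -> A s = A x + primitive n x s.
  move=> Is; rewrite /A !weighted_sub; try exact: oitv_left.
  exact: (Rintegral_oitv_left cn ni Is Ix).
have BE s : I s -> B s = B x - primitive n x s.
  move=> Is; rewrite /B !weighted_sub; try exact: oitv_right.
  exact: (Rintegral_oitv_right cn ni Is Ix).
have cP : continuous_on I (primitive n x) by exact: continuous_on_primitive.
have ncvg (f : R -> R) s c e : I s -> (forall u, I u -> f u = c + e * primitive n x u) ->
    {for s, continuous f}.
  move=> Is fE.
  have : {for s, continuous (fun u => c + e * primitive n x u)}.
    by apply: continuousD; [exact: cst_continuous|apply: continuousM; [exact: cst_continuous|exact: cP]].
  rewrite /prop_for /continuous_at fE//; apply: cvg_trans; apply: near_eq_cvg.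
  by have := open_nbhs_nbhs (conj oI Is); apply: filterS => u Iu; rewrite fE.
have cA s : I s -> {for s, continuous A}.
  by move=> Is; apply: (ncvg A s (A x) 1) => // u Iu; rewrite mul1r AE.
have cB s : I s -> {for s, continuous B}.
  by move=> Is; apply: (ncvg B s (B x) (-1)) => // u Iu; rewrite mulN1r BE.
have A0 s : I s -> 0 < A s.
  move=> Is; apply: fine_gt0; rewrite subfin ?andbT; [|exact: measurable_oitv|exact: oitv_left].
  have [z' Iz' z's] := oitv_lt_left Is; have [z'' Iz'' z''z'] := oitv_lt_left Iz'.
  apply: (@weighted_gt0 _ _ _ _ z'' z') => //; first exact: measurable_oitv.
    exact: oitv_left.
  move=> u /=; rewrite in_itv/= => /andP[z''u uz']; split.
    by have [lz _] := Iz''; apply: (lt_le_trans lz); rewrite lee_fin.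
  by rewrite lte_fin (le_lt_trans uz').
have B0 s : I s -> 0 < B s.
  move=> Is; apply: fine_gt0; rewrite subfin ?andbT; [|exact: measurable_oitv|exact: oitv_right].
  have [z' Iz' sz'] := oitv_lt_right Is; have [z'' Iz'' z'z''] := oitv_lt_right Iz'.
  apply: (@weighted_gt0 _ _ _ _ z' z'') => //; first exact: measurable_oitv.
    exact: oitv_right.
  move=> u /=; rewrite in_itv/= => /andP[z'u uz'']; split.
    by rewrite lte_fin (lt_le_trans sz').
  by have [_ zr] := Iz''; apply: le_lt_trans zr; rewrite lee_fin.
have Imin s : I s -> I (Num.min s x) by move=> Is; rewrite /Num.min; case: ifP.
have Imax s : I s -> I (Num.max s y) by move=> Is; rewrite /Num.max; case: ifP.
split.
  move=> s Is.
  have fE u : fxy M N (weighted I n) x y u =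
      Num.sqrt (B y / A x * A (Num.min u x) + (B (Num.max u y) - B y)).
    rewrite /fxy; case: (leP u y) => uy; first by rewrite subrr addr0.
    rewrite (min_r (ltW (lt_trans xy uy))) mulfVK ?gt_eqF ?A0//.
    by rewrite subrKC.
  rewrite (_ : fxy _ _ _ _ _ = fun u => Num.sqrt (B y / A x * A (Num.min u x) + (B (Num.max u y) - B y))); last first.
    exact/funext.
  apply: continuous_comp; last exact: sqrt_continuous.
  apply: continuousD.
    apply: continuousM; first exact: cst_continuous.
    apply: continuous_comp; last by apply: cA; exact: Imin.
    by apply: continuous_min; [exact: cvg_id|exact: cst_continuous].
  apply: continuousB; last exact: cst_continuous.
  apply: continuous_comp; last by apply: cB; exact: Imax.
  by apply: continuous_max; [exact: cvg_id|exact: cst_continuous].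
move=> s Is; rewrite /fxy; case: ifP => _; rewrite sqrtr_gt0; last exact: B0.
by rewrite mulr_gt0 ?divr_gt0//; [exact: B0|exact: A0|apply: A0; exact: Imin].
Qed.

(** * Energy of functions with compact support *)

(** Almost everywhere the total derivative [derive1 g] takes the value [q], so a
    measurable lower bound in terms of [q] is a lower bound of the energy. *)
Lemma ac_derive1_bound (R : realType) (I : set R) (c d : R) (n g : R -> R) (q : R -> R) (P : R -> R) :
  open I -> (forall x, I x -> 0 < n x) -> `[c, d]%classic `<=` I ->
  {ae lebesgue_measure, forall x, c < x -> x < d -> is_derive x 1 g (q x)} ->
  (forall x, c <= x -> x <= d -> 0 <= P x) ->
  measurable_fun (`[c, d]%classic : set (measurableTypeR R)) P ->
  {ae lebesgue_measure, forall x, c < x -> x < d -> is_derive x 1 g (q x) -> P x <= q x ^+ 2 / n x} ->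
  (\int[lebesgue_measure]_(x in `[c, d]) (P x)%:E <=
   \int[lebesgue_measure]_(x in I) (derive1 g x ^+ 2 / n x)%:E)%E.
Proof.
move=> oI n0 cdI gq P0 mP Pq; apply: ge0_le_integral_ae => //.
- exact/measurable_EFinP.
- by move=> x; rewrite /= in_itv/= => /andP[cx xd]; rewrite lee_fin P0.
- by move=> x Ix; rewrite lee_fin divr_ge0 ?sqr_ge0// ltW// n0.
have := lebesgue_ae_and (ae_neq c) (lebesgue_ae_and (ae_neq d) (lebesgue_ae_and gq Pq)).
apply: lebesgue_ae_imply => x [xc [xd [Gx Px]]]; rewrite /= in_itv/= => /andP[cx xd'].
have {}cx : c < x by rewrite lt_neqAle eq_sym xc.
have {xd}xd : x < d by rewrite lt_neqAle xd.
have [_ E] := Gx cx xd; rewrite lee_fin derive1E E.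
exact: Px (Gx cx xd).
Qed.

Lemma locally_AC_continuous (R : realType) (M N : \bar R) (g : R -> R) :
  locally_AC M N g -> continuous_on (oitv (- M)%E N) g.
Proof.
move=> acg x Ix.
have [c Ic cx] := oitv_lt_left Ix; have [d Id xd] := oitv_lt_right Ix.
have := ac_within_continuous (ltW (lt_trans cx xd)) (acg c d Ic Id).
move=> /(continuous_within_itvP _ (lt_trans cx xd))[+ _ _]; apply.
by rewrite in_itv/= cx xd.
Qed.

(** The support of [g] lies strictly between two points [c < t < d] at which [g]
    vanishes, so [potential_energy_bound] has no boundary terms. *)
Lemma dirichlet_energy_bound (R : realType) (M N : \bar R) (m n f g : R -> R) (K t : R) :
  let I := oitv (- M)%E N in
  let mm := weighted I m in let nn := weighted I n in
  continuous_on I m -> continuous_on I n -> continuous_on I f ->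
  (forall x, I x -> 0 < m x) -> (forall x, I x -> 0 < n x) -> (forall x, I x -> 0 < f x) ->
  I t -> (hminus M mm nn f t t < +oo)%E -> (hplus N mm nn f t t < +oo)%E ->
  (forall z, I z -> z < t -> (hminus M mm nn f t z <= (K * f z)%:E)%E) ->
  (forall z, I z -> t < z -> (hplus N mm nn f t z <= (K * f z)%:E)%E) ->
  locally_AC0 M N g ->
  (\int[lebesgue_measure]_(x in I) (g x ^+ 2 * m x)%:E = 1)%E ->
  0 < K /\
  ((K^-1)%:E <= \int[lebesgue_measure]_(x in I) (derive1 g x ^+ 2 / n x)%:E)%E.
Proof.
move=> I mm nn cm cn cf m0 n0 f0 It hmt hpt hmK hpK [acg [S [cS SI gS]]] g1.
have oI : open I by exact: open_oitv.
have [c [d [Ic Id [ct td] Scd]]] : exists c d, [/\ I c, I d, c < t /\ t < d &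
    forall x, S x -> c < x /\ x < d].
  have cSt : compact (S `|` [set t]) by apply: compactU => //; exact: compact_set1.
  have St0 : S `|` [set t] !=set0 by exists t; right.
  have StI : S `|` [set t] `<=` I by move=> x [/SI//|->].
  have idc : {within S `|` [set t], continuous (@idfun R)}.
    by apply: continuous_subspaceT => x; exact: cvg_id.
  have [q1 /set_mem /StI Iq1 q1min] := compact_EVT_min St0 cSt idc.
  have [q2 /set_mem /StI Iq2 q2max] := compact_EVT_max St0 cSt idc.
  have [c Ic cq1] := oitv_lt_left Iq1; have [d Id q2d] := oitv_lt_right Iq2.
  exists c, d; split => //.
    have tin : t \in S `|` [set t] by apply/mem_set; right.
    by split; [exact: lt_le_trans (q1min _ tin)|exact: le_lt_trans (q2max _ tin) _].
  move=> x Sx; have xin : x \in S `|` [set t] by apply/mem_set; left.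
  by split; [exact: lt_le_trans (q1min _ xin)|exact: le_lt_trans (q2max _ xin) _].
have gout x : I x -> ~ (c < x /\ x < d) -> g x = 0.
  by move=> Ix ncd; apply: gS => // /Scd.
have gc : g c = 0 by apply: gout => // -[]; rewrite ltxx.
have gd : g d = 0 by apply: gout => // -[]; rewrite ltxx.
have cd : c <= d by rewrite ltW// (lt_trans ct).
have acgcd := acg c d Ic Id.
have [k [ik _ gk]] := ac_ftc cd acgcd.
have mk : measurable_fun (`[c, d]%classic : set (measurableTypeR R)) k.
  by apply: measurable_funTS; case/integrableP : ik => /measurable_EFinP.
have [K0 [a [b [_ _ E]]]] := potential_energy_bound cm cn cf m0 n0 f0 It hmt hpt hmK hpK
  Ic Id ct td acgcd mk gk.
split => //; move: E; rewrite gc gd !expr0n/= !mul0r addr0 adde0 => E.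
have cdI : `[c, d]%classic `<=` I by exact: itvcc_oitv.
have KE : (\int[lebesgue_measure]_(x in `[c, d]) (K^-1 * m x * g x ^+ 2)%:E = (K^-1)%:E)%E.
  under eq_integral do rewrite -mulrA EFinM.
  rewrite ge0_integralZl//; first last.
  - by rewrite lee_fin invr_ge0 ltW.
  - by move=> x /cdI Ix; rewrite lee_fin mulr_ge0 ?sqr_ge0// ltW// m0.
  - apply/measurable_EFinP/measurable_funM.
      exact: (continuous_on_measurable oI).
    apply: measurable_funX; apply: (continuous_on_measurable oI (locally_AC_continuous acg)) => //.
  rewrite (_ : integral _ _ _ = 1%E) ?mule1// -g1 integral_mkcond [RHS]integral_mkcond.
  apply: eq_integral => x _; rewrite !patchE.
  have [xcd|xcd] := boolP (x \in `[c, d]%classic).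
    by rewrite (mem_set (cdI x (set_mem xcd))) mulrC.
  case: ifPn => // /set_mem Ix; rewrite gout ?expr0n ?mul0r// => -[cx xd].
  by move: xcd; rewrite notin_setE/=; apply; rewrite in_itv/= !ltW.
rewrite -KE; apply: le_trans E _.
apply: (ac_derive1_bound oI n0 cdI gk).
- by move=> x cx xd; rewrite divr_ge0 ?sqr_ge0// ltW// n0//; apply: cdI; rewrite /= in_itv/= cx.
- apply: measurable_funM; first exact: measurable_funX.
  apply: (@continuous_on_measurable _ I) => //.
  by move=> x Ix; apply: continuousV; [rewrite gt_eqF// n0|exact: cn].
- by apply: lebesgue_ae_imply (ae_neq c) => x *.
Qed.

(** * Energy of functions with mean zero *)

Lemma nonvanishing_constant_sign (R : realType) (J : set R) (g : R -> R) :
  is_interval J -> continuous_on J g -> (forall x, J x -> g x != 0) ->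
  (forall x, J x -> 0 < g x) \/ (forall x, J x -> g x < 0).
Proof.
move=> iJ cg gn0.
have key x y : J x -> J y -> x <= y -> 0 < g x * g y.
  move=> Jx Jy xy; rewrite ltNge; apply/negP => gxy.
  have [||z] := @IVT R g x y 0 xy.
  - apply: continuous_in_subspaceT => z; rewrite inE/= in_itv/= => xzy.
    by apply: cg; exact: iJ xzy.
  - rewrite ge_min le_max; have [gx|gx] := leP (g x) 0.
      rewrite /=; have {}gx : g x < 0 by rewrite lt_neqAle gn0.
      by rewrite -(nmulr_rle0 (g y) gx) gxy orbT.
    by rewrite /= -(pmulr_rle0 (g y) gx) gxy (ltW gx).
  - by rewrite in_itv/= => xzy gz; have := gn0 z (iJ _ _ Jx Jy _ xzy); rewrite gz eqxx.
have {}key x y : J x -> J y -> 0 < g x * g y.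
  by move=> Jx Jy; have [xy|/ltW yx] := leP x y; [|rewrite mulrC]; exact: key.
have [[x Jx gx]|H] := pselect (exists2 x, J x & 0 < g x).
  by left => y Jy; rewrite -(pmulr_rgt0 _ gx) key.
right => y Jy; rewrite lt_neqAle gn0//= leNgt; apply/negP => gy.
by apply: H; exists y.
Qed.

Lemma Rintegral_same_sign (R : realType) (J E : set R) (g n : R -> R) (c : R) :
  is_interval J -> continuous_on J g -> (forall x, J x -> 0 <= n x) ->
  measurable (E : set (measurableTypeR R)) -> E `<=` J -> J c ->
  (@lebesgue_measure R).-integrable E (EFin \o (fun x => g x * n x)) ->
  (forall x, J x -> g x != 0) ->
  0 <= g c * \int[lebesgue_measure]_(x in E) (g x * n x).
Proof.
move=> iJ cg n0 mE EJ Jc ig gn0.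
have [g0|g0] := nonvanishing_constant_sign iJ cg gn0.
- by rewrite mulr_ge0 ?(ltW (g0 c Jc))//; apply: Rintegral_ge0 => x /EJ Jx;
    rewrite mulr_ge0 ?n0// ltW// g0.
- rewrite mulr_le0 ?(ltW (g0 c Jc))// -oppr_ge0 -mulN1r -RintegralZl//.
  apply: Rintegral_ge0 => x /EJ Jx.
  by rewrite mulN1r oppr_ge0 mulr_le0_ge0 ?n0// ltW// g0.
Qed.

(** A zero of [g] to the left of [c0] is a solution.  If there is none, [g] has a
    constant sign there, and its weighted integral over [(l, c)] has this sign. *)
Lemma exists_left_end (R : realType) (l r : \bar R) (g n : R -> R) (c0 : R) :
  let I := oitv l r in
  continuous_on I g -> (forall x, I x -> 0 < n x) ->
  (@lebesgue_measure R).-integrable I (EFin \o (fun x => g x * n x)) -> I c0 ->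
  exists c, [/\ I c, c < c0 &
    0 <= g c * \int[lebesgue_measure]_(x in oitv l c%:E) (g x * n x)].
Proof.
move=> I cg n0 ig Ic0; apply: contrapT => H.
have Jsub : oitv l c0%:E `<=` I by exact: oitv_left.
have [c Ic cc0] := oitv_lt_left Ic0.
have Jc : oitv l c0%:E c by split; [have [] := Ic|rewrite lte_fin].
apply: (H); exists c; split => //; apply: (@Rintegral_same_sign _ (oitv l c0%:E)).
- exact: is_interval_oitv.
- by move=> x /Jsub; exact: cg.
- by move=> x /Jsub Ix; rewrite ltW// n0.
- exact: measurable_oitv.
- by apply: (oitv_left Jc).
- by [].
- by apply: integrableS ig; [exact: measurable_oitv|exact: measurable_oitv|exact: oitv_left].
- move=> x Jx; apply/eqP => gx0; apply: H; exists x; split.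
  + exact: Jsub.
  + by have [_] := Jx; rewrite lte_fin.
  + by rewrite gx0 mul0r.
Qed.

(** The mirror image of [exists_left_end]. *)
Lemma exists_right_end (R : realType) (l r : \bar R) (g n : R -> R) (d0 : R) :
  let I := oitv l r in
  continuous_on I g -> (forall x, I x -> 0 < n x) ->
  (@lebesgue_measure R).-integrable I (EFin \o (fun x => g x * n x)) -> I d0 ->
  exists d, [/\ I d, d0 < d &
    0 <= g d * \int[lebesgue_measure]_(x in oitv d%:E r) (g x * n x)].
Proof.
move=> I cg n0 ig Id0; apply: contrapT => H.
have Jsub : oitv d0%:E r `<=` I by exact: oitv_right.
have [d Id d0d] := oitv_lt_right Id0.
have Jd : oitv d0%:E r d by split; [rewrite lte_fin|have [] := Id].
apply: (H); exists d; split => //; apply: (@Rintegral_same_sign _ (oitv d0%:E r)).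
- exact: is_interval_oitv.
- by move=> x /Jsub; exact: cg.
- by move=> x /Jsub Ix; rewrite ltW// n0.
- exact: measurable_oitv.
- by apply: (oitv_right Jd).
- by [].
- by apply: integrableS ig; [exact: measurable_oitv|exact: measurable_oitv|exact: oitv_right].
- move=> x Jx; apply/eqP => gx0; apply: H; exists x; split.
  + exact: Jsub.
  + by have [+ _] := Jx; rewrite lte_fin.
  + by rewrite gx0 mul0r.
Qed.

Lemma oitv_left_sequence (R : realType) (l : \bar R) (t : R) : (l < t%:E)%E ->
  exists u : nat -> R, [/\ forall k, (l < (u k)%:E)%E, forall k, u k < t,
    {homo u : a b / (a <= b)%N >-> b <= a} &
    forall x, (l < x%:E)%E -> exists k, u k <= x].
Proof.
case: l => [l|//|].
- rewrite lte_fin => lt; pose u k : R := l + (t - l) / k.+2%:R.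
  exists u; split.
  + by move=> k; rewrite lte_fin /u ltrDl divr_gt0// subr_gt0.
  + move=> k; rewrite /u -ltrBrDl ltr_pdivrMr// ltr_pMr ?subr_gt0//.
    by rewrite ltr1n.
  + move=> a b ab; rewrite lerD2l ler_pM2l ?subr_gt0// lef_pV2 ?posrE// ler_nat.
    by rewrite !ltnS.
  + move=> x; rewrite lte_fin => lx; pose k := Num.truncn ((t - l) / (x - l)).
    exists k; rewrite /u -lerBrDl ler_pdivrMr// mulrC -ler_pdivrMr ?subr_gt0//.
    by rewrite (le_trans (ltW (truncnS_gt _)))// ler_nat.
- move=> _; pose u k : R := t - k.+1%:R; exists u; split.
  + by move=> k; rewrite ltNyr.
  + by move=> k; rewrite /u ltrBlDr ltrDl.
  + by move=> a b ab; rewrite /u lerD2l lerN2 ler_nat ltnS.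
  + move=> x _; exists (Num.truncn (t - x)); rewrite /u lerBlDr -lerBlDl.
    by rewrite ltW// truncnS_gt.
Qed.

Lemma oitv_right_sequence (R : realType) (r : \bar R) (t : R) : (t%:E < r)%E ->
  exists v : nat -> R, [/\ forall k, ((v k)%:E < r)%E, forall k, t < v k,
    {homo v : a b / (a <= b)%N >-> a <= b} &
    forall x, (x%:E < r)%E -> exists k, x <= v k].
Proof.
move=> tr; have : (- r < (- t)%:E)%E by rewrite EFinN lteN2.
move=> /oitv_left_sequence[u [ul ut nu lu]]; exists (fun k => - u k); split.
- by move=> k; rewrite EFinN lteNl.
- by move=> k; rewrite ltrNr.
- by move=> a b ab; rewrite lerN2 nu.
- move=> x xr; have [|k] := lu (- x); first by rewrite EFinN lteN2.
  by exists k; rewrite lerNr.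
Qed.

Lemma integral_oitv_exhaust (R : realType) (l r : \bar R) (t s : R) (g : R -> R) :
  let I := oitv l r in
  continuous_on I g -> (forall x, I x -> 0 <= g x) -> I t ->
  (s%:E < \int[lebesgue_measure]_(x in I) (g x)%:E)%E ->
  exists c0 d0, [/\ I c0, I d0, c0 < t, t < d0 &
    forall c d, I c -> I d -> c <= c0 -> d0 <= d ->
      (s%:E < \int[lebesgue_measure]_(x in `[c, d]) (g x)%:E)%E].
Proof.
move=> I cg g0 It sI; have oI : open I by exact: open_oitv.
have [u [lu ut nu ul]] := oitv_left_sequence It.1.
have [v [vr tv nv rv]] := oitv_right_sequence It.2.
have Iu k : I (u k).
  by split => //; apply: lt_trans It.2; rewrite lte_fin.
have Iv k : I (v k).
  by split => //; apply: lt_trans It.1 _; rewrite lte_fin.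
pose F k : set (measurableTypeR R) := `[u k, v k]%classic.
have FI k : F k `<=` I by exact: (itvcc_oitv (Iu k) (Iv k)).
have mFk k : measurable (F k) by exact: measurable_itv.
have mF k : measurable_fun (F k) (fun x => (g x)%:E).
  by apply/measurable_EFinP; exact: (continuous_on_measurable oI cg (mFk k) (FI k)).
have cupF : \bigcup_k F k = I.
  apply/seteqP; split => [x [k _ /FI]//|x [lx xr]].
  have [a ua] := ul x lx; have [b vb] := rv x xr.
  exists (maxn a b) => //; rewrite /F/= in_itv/=.
  by rewrite (le_trans (nu _ _ (leq_maxl a b)))// (le_trans vb)// nv// leq_maxr.
have ndF : {homo F : a b / (a <= b)%N >-> (a <= b)%O}.
  by move=> a b ab; apply/subsetPset; apply: subset_itv; rewrite bnd_simp ?nu ?nv.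
have cvgF : (\int[lebesgue_measure]_(x in F k) (g x)%:E @[k --> \oo] -->
    \int[lebesgue_measure]_(x in I) (g x)%:E)%E.
  by rewrite -cupF; apply: ge0_nondecreasing_set_cvg_integral => // k x /FI Ix; rewrite lee_fin g0.
have [k sk] : exists k, (s%:E < \int[lebesgue_measure]_(x in F k) (g x)%:E)%E.
  apply: contrapT => H; move: sI; rewrite ltNge => /negP; apply.
  rewrite -(cvg_lim _ cvgF)//; apply: lime_le; first by apply/cvg_ex; eexists; exact: cvgF.
  by apply: nearW => k; rewrite leNgt; apply/negP => sk; apply: H; exists k.
exists (u k), (v k); split => // c d Ic Id cu vd; apply: lt_le_trans sk _.
have cdI : `[c, d]%classic `<=` I by exact: itvcc_oitv.
apply: ge0_subset_integral => //.
- by apply/measurable_EFinP; apply: (continuous_on_measurable oI).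
- by move=> x /cdI Ix; rewrite lee_fin g0.
- by apply: subset_itv; rewrite bnd_simp.
Qed.

(** Integrate [0 <= (g - s)^2 n] with [s = a G], where [G] is the integral of
    [g n], and use that [a] times the mass of [E] is at most [1]. *)
Lemma weighted_cauchy_schwarz (R : realType) (I E : set R) (g n : R -> R) (a : R) :
  measurable (E : set (measurableTypeR R)) -> E `<=` I ->
  (forall x, E x -> 0 <= n x) ->
  (@lebesgue_measure R).-integrable E (EFin \o n) ->
  (@lebesgue_measure R).-integrable E (EFin \o (fun x => g x * n x)) ->
  (@lebesgue_measure R).-integrable E (EFin \o (fun x => g x ^+ 2 * n x)) ->
  0 <= a -> (a%:E * weighted I n E <= 1)%E ->
  (\int[lebesgue_measure]_(x in E) (g x * n x)) ^+ 2 * a <=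
  \int[lebesgue_measure]_(x in E) (g x ^+ 2 * n x).
Proof.
move=> mE EI n0 ni gni g2ni a0; rewrite weighted_sub//.
set G := \int[lebesgue_measure]_(x in E) (g x * n x).
set W := \int[lebesgue_measure]_(x in E) (n x).
have WE : (\int[lebesgue_measure]_(x in E) (n x)%:E)%E = W%:E.
  by rewrite /W /Rintegral fineK//; exact: integrable_fin_num.
rewrite WE -EFinM lee_fin => aW.
pose s := a * G.
have i1 : (@lebesgue_measure R).-integrable E (EFin \o (fun x => (s *+ 2) * (g x * n x))).
  by have := integrableZl mE (s *+ 2) gni.
have i2 : (@lebesgue_measure R).-integrable E (EFin \o (fun x => s ^+ 2 * n x)).
  by have := integrableZl mE (s ^+ 2) ni.
have i3 : (@lebesgue_measure R).-integrable E
    (EFin \o (fun x => (s *+ 2) * (g x * n x) - s ^+ 2 * n x)).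
  by have := integrableB mE i1 i2.
have : \int[lebesgue_measure]_(x in E) ((s *+ 2) * (g x * n x) - s ^+ 2 * n x) <=
    \int[lebesgue_measure]_(x in E) (g x ^+ 2 * n x).
  apply: le_Rintegral => // x Ex; rewrite -subr_ge0.
  rewrite (_ : _ - _ = (g x - s) ^+ 2 * n x); last by ring.
  by rewrite mulr_ge0 ?sqr_ge0// n0.
rewrite RintegralB// RintegralZl// RintegralZl// -/G -/W; apply: le_trans.
have h : a * G ^+ 2 * (a * W) <= a * G ^+ 2.
  by rewrite ler_piMr// mulr_ge0// sqr_ge0.
rewrite /s; move: h; lra.
Qed.

Lemma integral_weighted_signed (R : realType) (I : set R) (n g : R -> R) :
  open I -> continuous_on I n -> (forall x, I x -> 0 < n x) -> continuous_on I g ->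
  (\int[weighted I n]_(x in I) (g x)%:E = \int[lebesgue_measure]_(x in I) (g x * n x)%:E)%E.
Proof.
move=> oI cn n0 cg; have mI := open_measurable oI.
have n0' x : I x -> 0 <= n x by move=> Ix; rewrite ltW// n0.
have mr : measurable_fun setT (n \_ I).
  by apply: (measurable_restrictT _ mI).1; apply: (continuous_on_measurable oI).
have r0 x : 0 <= (n \_ I) x by rewrite patchE; case: ifPn => // /[!inE]; exact: n0'.
have mg : measurable_fun (I : set (measurableTypeR R)) (fun x => (g x)%:E).
  by apply/measurable_EFinP; apply: (continuous_on_measurable oI).
have -> : (\int[weighted I n]_(x in I) (g x)%:E =
    \int[weighted I n]_(x in I) ((fun x => (g x)%:E)^\+ x) -
    \int[weighted I n]_(x in I) ((fun x => (g x)%:E)^\- x))%E.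
  rewrite weightedE.
  rewrite -[with_density _ _]/(with_density_measure (@lebesgue_measure R) mr r0 : set _ -> \bar R).
  exact: integralE.
rewrite !integral_weighted//; last 2 first.
- exact: measurable_funeneg.
- exact: measurable_funepos.
rewrite [RHS]integralE; congr (_ - _)%E; apply: eq_integral => x /[!inE] Ix.
- by rewrite !funeposE -!EFin_max -EFinM maxr_pMl ?mul0r// n0'.
- by rewrite !funenegE -!EFinN -!EFin_max -EFinM maxr_pMl ?mul0r ?mulNr// n0'.
Qed.

Lemma Rintegral_oitv_mid (R : realType) (l r : \bar R) (x : R) (g : R -> R) :
  let I := oitv l r in
  (@lebesgue_measure R).-integrable I (EFin \o g) -> I x ->
  \int[lebesgue_measure]_(u in I) g u =
  \int[lebesgue_measure]_(u in oitv l x%:E) g u +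
  \int[lebesgue_measure]_(u in oitv x%:E r) g u.
Proof.
move=> I ig Ix.
have E : I = oitv l x%:E `|` ([set x] `|` oitv x%:E r).
  apply/seteqP; split => u.
    move=> [lu ur]; have [ux|xu|->] := ltgtP u x; [left|right; right|right; left] => //.
  by move=> [/(oitv_left Ix)|[->|/(oitv_right Ix)]].
have mB : measurable ([set x] `|` oitv x%:E r : set (measurableTypeR R)).
  by apply: measurableU => //; exact: measurable_oitv.
have iB : (@lebesgue_measure R).-integrable ([set x] `|` oitv x%:E r) (EFin \o g).
  apply: integrableS ig => //; first exact: measurable_oitv.
  by rewrite E; exact: subsetUr.
rewrite E Rintegral_setU//; last 3 first.
- exact: measurable_oitv.
- by rewrite -E.
- apply/disj_set2P/seteqP; split => // u /= [[_ ux]] [uE|[xu _]].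
    by move: ux; rewrite uE ltxx.
  by have := lt_trans ux xu; rewrite ltxx.
congr (_ + _); rewrite Rintegral_setU//; last 2 first.
- exact: measurable_oitv.
- by apply/disj_set2P/seteqP; split => // u /= [-> [+ _]]; rewrite ltxx.
by rewrite Rintegral_set1 add0r.
Qed.

(** Here [G] is the integral of [phi = g n] from the left end, which is minus the
    integral up to the right end since [g] has mean zero.  The Hardy inequality
    for [G] bounds the integral of [J = m G^2 / K] by the norm of [g], and the
    energy of [g] enters through the derivative of [g G]. *)
Lemma neumann_energy_bound (R : realType) (M N : \bar R) (m n f g : R -> R) (K t : R) :
  let I := oitv (- M)%E N in
  let mm := weighted I m in let nn := weighted I n in
  continuous_on I m -> continuous_on I n -> continuous_on I f ->
  (forall x, I x -> 0 < m x) -> (forall x, I x -> 0 < n x) -> (forall x, I x -> 0 < f x) ->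
  (nn I < +oo)%E ->
  I t -> (hminus M mm nn f t t < +oo)%E -> (hplus N mm nn f t t < +oo)%E ->
  (forall z, I z -> z < t -> (hminus M mm nn f t z <= (K * f z)%:E)%E) ->
  (forall z, I z -> t < z -> (hplus N mm nn f t z <= (K * f z)%:E)%E) ->
  locally_AC M N g ->
  (\int[lebesgue_measure]_(x in I) (g x * n x)%:E = 0)%E ->
  (\int[lebesgue_measure]_(x in I) (g x ^+ 2 * n x)%:E = 1)%E ->
  0 < K /\
  ((K^-1)%:E <= \int[lebesgue_measure]_(x in I) (derive1 g x ^+ 2 / m x)%:E)%E.
Proof.
move=> I mm nn cm cn cf m0 n0 f0 nnI It hmt hpt hmK hpK acg gn0 g1.
have oI : open I by exact: open_oitv.
have iI : is_interval I by exact: is_interval_oitv.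
have mI : measurable (I : set (measurableTypeR R)) by exact: measurable_oitv.
have cg : continuous_on I g by exact: locally_AC_continuous.
pose phi x : R := g x * n x; pose psi x : R := g x ^+ 2 * n x.
have cphi : continuous_on I phi by exact: continuous_onM.
have cpsi : continuous_on I psi.
  by apply: continuous_onM => //; rewrite (_ : (fun x => _) = (fun x => g x * g x)) //; exact: continuous_onM.
have psi0 x : I x -> 0 <= psi x by move=> Ix; rewrite mulr_ge0 ?sqr_ge0// ltW// n0.
have meas (h : R -> R) (E : set R) : continuous_on I h -> measurable (E : set (measurableTypeR R)) ->
    E `<=` I -> measurable_fun (E : set (measurableTypeR R)) h.
  by move=> ch mE EI; exact: (continuous_on_measurable oI).
have ni := weighted_integrable oI cn n0 nnI.
have psii : (@lebesgue_measure R).-integrable I (EFin \o psi).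
  apply/integrableP; split; first by apply/measurable_EFinP; exact: meas.
  rewrite (_ : integral _ _ _ = 1)%E ?ltry// -g1.
  by apply: eq_integral => x /[!inE] Ix; rewrite /= ger0_norm// psi0.
have phii : (@lebesgue_measure R).-integrable I (EFin \o phi).
  apply: (le_integrable mI _ _ (integrableD mI ni psii)).
    by apply/measurable_EFinP; exact: meas.
  move=> x Ix; rewrite /= lee_fin [leRHS]ger0_norm ?addr_ge0 ?psi0 ?(ltW (n0 x Ix))//.
  rewrite /phi /psi normrM (gtr0_norm (n0 x Ix)) -{2}[n x]mul1r -mulrDl ler_wpM2r ?(ltW (n0 x Ix))//.
  by rewrite -real_normK ?num_real//; have := sqr_ge0 (`|g x| - 1); have := normr_ge0 (g x); nra.
have subi (h : R -> R) (E : set R) : measurable (E : set (measurableTypeR R)) -> E `<=` I ->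
    (@lebesgue_measure R).-integrable I (EFin \o h) ->
    (@lebesgue_measure R).-integrable E (EFin \o h).
  by move=> mE EI; exact: integrableS.
pose L x := oitv (- M)%E x%:E; pose U x := oitv x%:E N.
have mL x : measurable (L x : set (measurableTypeR R)) by exact: measurable_oitv.
have mU x : measurable (U x : set (measurableTypeR R)) by exact: measurable_oitv.
have LI x : I x -> L x `<=` I by exact: oitv_left.
have UI x : I x -> U x `<=` I by exact: oitv_right.
pose G x : R := \int[lebesgue_measure]_(u in L t) phi u + primitive phi t x.
have GE x : I x -> \int[lebesgue_measure]_(u in L x) phi u = G x.
  by move=> Ix; exact: (Rintegral_oitv_left cphi phii).
have GE' x : I x -> \int[lebesgue_measure]_(u in U x) phi u = - G x.
  move=> Ix; have := Rintegral_oitv_mid phii Ix; rewrite {1}/Rintegral gn0/= (GE x Ix).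
  by move=> H; apply/eqP; rewrite -addr_eq0 addrC -H.
have dG x : I x -> is_derive x 1 G (phi x).
  move=> Ix; have dP := is_derive_primitive oI iI cphi It Ix.
  have := is_deriveD (is_derive_cst (\int[lebesgue_measure]_(u in L t) phi u) x 1) dP.
  by rewrite add0r.
have main s : s < 1 -> 0 < K /\ (((2 * s - 1) / K)%:E <=
    \int[lebesgue_measure]_(x in I) (derive1 g x ^+ 2 / m x)%:E)%E.
  move=> s1.
  have sI : (s%:E < \int[lebesgue_measure]_(x in I) (psi x)%:E)%E by rewrite g1 lte_fin.
  have [c0 [d0 [Ic0 Id0 c0t td0 cdpsi]]] := integral_oitv_exhaust cpsi psi0 It sI.
  have [c [Ic cc0 gcG]] := exists_left_end cg n0 phii Ic0.
  have [d [Id d0d gdG]] := exists_right_end cg n0 phii Id0.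
  have {gcG}gcG : 0 <= g c * G c by rewrite -(GE c Ic).
  have {gdG}gdG : g d * G d <= 0 by rewrite -oppr_ge0 -mulrN -(GE' d Id).
  have ct : c < t by exact: lt_trans c0t.
  have td : t < d by exact: lt_trans d0d.
  have cd : c <= d by rewrite ltW// (lt_trans ct).
  have cdI : `[c, d]%classic `<=` I by exact: itvcc_oitv.
  have Icd x : c <= x -> x <= d -> I x by move=> cx xd; apply: cdI; rewrite /= in_itv/= cx.
  have acG : abs_continuous_on c d G.
    by apply: (C1_ac cd (df := phi)) => x cx xd; [exact/dG/Icd|exact/cphi/Icd].
  have Gphi : {ae (@lebesgue_measure R), forall x, c < x -> x < d -> is_derive x 1 G (phi x)}.
    by apply: lebesgue_ae_imply (ae_neq c) => x _ cx xd; apply/dG/Icd; exact: ltW.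
  have mphi : measurable_fun (`[c, d]%classic : set (measurableTypeR R)) phi by exact: meas.
  have [K0 [a [b [[a0 an] [b0 bn] E]]]] := potential_energy_bound cm cn cf m0 n0 f0 It hmt hpt
    hmK hpK Ic Id ct td acG mphi Gphi.
  split => //.
  pose J x : R := K^-1 * m x * G x ^+ 2.
  have cG : continuous_on I G by move=> x Ix; apply: is_derive1_continuous; exact: dG.
  have cJ : continuous_on I J.
    apply: continuous_onM; first by apply: continuous_onM => // x _; exact: cst_continuous.
    by rewrite (_ : (fun x => _) = (fun x => G x * G x)) //; exact: continuous_onM.
  have cdi (h : R -> R) : continuous_on I h -> (@lebesgue_measure R).-integrable `[c, d] (EFin \o h).
    by move=> ch; exact: (continuous_on_integrable iI ch).
  have toR (h : R -> R) : continuous_on I h -> (\int[lebesgue_measure]_(x in `[c, d]) (h x)%:E =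
      (\int[lebesgue_measure]_(x in `[c, d]) h x)%:E)%E.
    by move=> ch; rewrite /Rintegral fineK//; apply: integrable_fin_num => //; exact: cdi.
  have J1 : \int[lebesgue_measure]_(x in `[c, d]) J x <= 1.
    have h1 : G c ^+ 2 * a <= \int[lebesgue_measure]_(x in L c) psi x.
      rewrite -(GE c Ic); apply: (@weighted_cauchy_schwarz _ I) => //; try (by apply: subi; [|exact: LI|]).
      - exact: LI.
      - by move=> x /(LI c Ic) Ix; rewrite ltW// n0.
    have h2 : G d ^+ 2 * b <= \int[lebesgue_measure]_(x in U d) psi x.
      rewrite -[G d]opprK -(GE' d Id) sqrrN; apply: (@weighted_cauchy_schwarz _ I) => //; try (by apply: subi; [|exact: UI|]).
      - exact: UI.
      - by move=> x /(UI d Id) Ix; rewrite ltW// n0.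
    have psi1 : \int[lebesgue_measure]_(x in L c) psi x + \int[lebesgue_measure]_(x in `[c, d]) psi x +
        \int[lebesgue_measure]_(x in U d) psi x = 1.
      have := Rintegral_oitv_mid psii Ic; rewrite {1}/Rintegral g1/= => ->.
      rewrite (Rintegral_oitv_right cpsi psii Ic Id).
      have := primitiveB iI cpsi Id Ic Id cd; rewrite primitive_refl => <-.
      by rewrite /L /U; ring.
    move: E; rewrite (toR J)//.
    rewrite (_ : integral _ _ _ = \int[lebesgue_measure]_(x in `[c, d]) (psi x)%:E)%E; last first.
      apply: eq_integral => x /[!inE] /cdI Ix; congr EFin; rewrite /phi /psi.
      by have := n0 x Ix => nx; field; rewrite gt_eqF.
    rewrite (toR psi)// -EFinD lee_fin => /le_trans; apply.
    by rewrite -psi1 [leRHS]addrAC [leRHS]addrC lerD2l lerD.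
  have acgcd := acg c d Ic Id.
  have [k [ik _ gk]] := ac_ftc cd acgcd.
  have [q [iq qE Pq]] := ac_ftc cd (acM cd acgcd acG).
  have iqcd : (@lebesgue_measure R).-integrable `[c, d] (EFin \o q).
    exact: integrableS iq.
  have Q0 : \int[lebesgue_measure]_(x in `[c, d]) q x <= 0.
    by rewrite /Rintegral (qE d)//= subr_le0 (le_trans gdG).
  have S0 : s < \int[lebesgue_measure]_(x in `[c, d]) psi x.
    by rewrite -lte_fin -toR//; apply: cdpsi => //; exact: ltW.
  have mcd : measurable (`[c, d]%classic : set (measurableTypeR R)) by exact: measurable_itv.
  (* As [q = k G + psi], the difference [k^2 / m - T] is the square
     [(k + m G / K)^2 / m], while the integrals of [psi], [q] and [J] are at
     least [s], at most [0] and at most [1]. *)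
  pose T x : R := 2 / K * (psi x - q x) - K^-1 * J x.
  have i1 : (@lebesgue_measure R).-integrable `[c, d] (EFin \o (fun x => psi x - q x)).
    by have := integrableB mcd (cdi psi cpsi) iqcd.
  have i2 : (@lebesgue_measure R).-integrable `[c, d] (EFin \o (fun x => 2 / K * (psi x - q x))).
    by have := integrableZl mcd (2 / K) i1.
  have i3 : (@lebesgue_measure R).-integrable `[c, d] (EFin \o (fun x => K^-1 * J x)).
    by have := integrableZl mcd K^-1 (cdi J cJ).
  have iT : (@lebesgue_measure R).-integrable `[c, d] (EFin \o T).
    by have := integrableB mcd i2 i3.
  have KV : 0 < K^-1 by rewrite invr_gt0.
  have alg (x1 x2 x3 : R) : x1 <= 1 -> x2 <= 0 -> s < x3 ->
      (2 * s - 1) / K <= 2 / K * (x3 - x2) - K^-1 * x1.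
    move=> x11 x20 sx3; rewrite [leRHS](_ : _ = (2 * (x3 - x2) - x1) / K); last by ring.
    by rewrite ler_pM2r//; clear -x11 x20 sx3; lra.
  have TE : (2 * s - 1) / K <= \int[lebesgue_measure]_(x in `[c, d]) T x.
    rewrite /T RintegralB// RintegralZl// RintegralB//; last exact: cdi.
    rewrite RintegralZl//; last exact: cdi.
    exact: alg.
  pose P x : R := Num.max 0 (T x).
  have mT : measurable_fun (`[c, d]%classic : set (measurableTypeR R)) T.
    by case/integrableP : iT => /measurable_EFinP.
  apply: (@le_trans _ _ (\int[lebesgue_measure]_(x in `[c, d]) (P x)%:E)%E).
    have iP : (@lebesgue_measure R).-integrable `[c, d] (EFin \o P).
      rewrite (_ : EFin \o P = (EFin \o T)^\+%E); first exact: integrable_funepos.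
      by apply/funext => x; rewrite funeposE/= -EFin_max /P maxC.
    rewrite (_ : integral _ _ _ = (\int[lebesgue_measure]_(x in `[c, d]) P x)%:E); last first.
      by rewrite /Rintegral fineK//; exact: integrable_fin_num.
    rewrite lee_fin (le_trans TE)//; apply: le_Rintegral => // x _.
    by rewrite /P le_max lexx orbT.
  apply: (ac_derive1_bound oI m0 cdI gk).
  - by move=> x _ _; rewrite /P le_max lexx.
  - exact: measurable_maxr.
  apply: lebesgue_ae_imply Pq => x Px cx xd gx; have Ix := Icd x (ltW cx) (ltW xd).
  have qx : q x = g x * phi x + G x * k x.
    exact: is_derive1_unique (Px cx xd) (is_deriveM gx (dG x Ix)).
  have mx := m0 x Ix.
  rewrite /P ge_max divr_ge0 ?sqr_ge0 ?(ltW mx)//= /T qx /phi /psi /J -subr_ge0.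
  rewrite (_ : _ - _ = (k x + m x * G x / K) ^+ 2 / m x).
    by rewrite divr_ge0 ?sqr_ge0// ltW.
  by field; rewrite !gt_eqF.
have [K0 _] := main 0 ltr01; split => //.
apply/lee_addgt0Pr => e e0; rewrite -leeBlDr// -EFinB.
have [|_] := main (1 - (e : R) * K / 2); first by rewrite ltrBlDr ltrDl divr_gt0// mulr_gt0.
apply: le_trans; rewrite lee_fin le_eqVlt; apply/orP; left; apply/eqP.
by field; rewrite gt_eqF.
Qed.

(** * The two estimates *)

(** Inversion reverses the order of the nonnegative extended reals, so it suffices
    to bound every member of the infimum from below by the inverse of [D]. *)
Lemma kappa_inv_le (R : realType) (M N : \bar R)
    (mm nn : set (measurableTypeR R) -> \bar R) (D : \bar R) :
  (0 <= D)%E ->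
  (forall x y K, oitv (- M)%E N x -> oitv (- M)%E N y -> x < y ->
    (max_sup_II M N mm nn (fxy M N nn x y) <= K%:E)%E -> 0 < K /\ ((K^-1)%:E <= D)%E) ->
  ((kappa M N mm nn)^-1 <= D)%E.
Proof.
move=> D0 H.
have DVk : (D^-1 <= kappa M N mm nn)%E.
  apply: le_ereal_inf_tmp => _ [x [y [Ix Iy xy ->]]].
  have := fun K => H x y K Ix Iy xy; case: (max_sup_II _ _ _ _ _) => [K|_|H0].
  - move=> /(_ K (lexx _))[K0 KD]; rewrite inve_ple ?inE//; last by rewrite lee_fin ltW.
    by rewrite inver gt_eqF.
  - exact: leey.
  (* A supremum equal to [-oo] would admit the bound [K = 0]. *)
  - by have [] := H0 0 (leNye _); rewrite ltxx.
rewrite inve_ple ?inE//; apply: le_trans DVk; by rewrite inve_ge0.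
Qed.

Lemma L2norm_eq1 (R : realType) (M N : \bar R) (a b : R -> R) (x0 : R) (n f : R -> R) :
  let I := oitv (- M)%E N in
  mu M N a b x0 = weighted I n ->
  continuous_on I n -> (forall x, I x -> 0 < n x) -> continuous_on I f ->
  L2norm M N a b x0 f = 1%E ->
  (\int[lebesgue_measure]_(x in I) (f x ^+ 2 * n x)%:E = 1)%E.
Proof.
move=> I muE cn n0 cf; rewrite /L2norm muE.
have oI : open I by exact: open_oitv.
rewrite integral_weighted//; last 4 first.
- by move=> x Ix; rewrite ltW// n0.
- exact: measurable_oitv.
- by move=> x _; rewrite lee_fin sqr_ge0.
- apply/measurable_EFinP/measurable_funX; apply: (continuous_on_measurable oI) => //.
  exact: measurable_oitv.
under eq_integral do rewrite -EFinM.
set s := integral _ _ _ => s1.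
have s0 : (0 <= s)%E.
  by apply: integral_ge0 => x Ix; rewrite lee_fin mulr_ge0 ?sqr_ge0// ltW// n0.
by rewrite -[LHS]poweRe1// -[1%R in LHS](@mulVf R 2)// poweRrM s1 poweR1r.
Qed.

Theorem corollary4p3 (R : realType) (M N : \bar R)
    (M_gt0 : (0 < M)%E) (N_gt0 : (0 < N)%E)
    (a b : R -> R)
    (a_cont : {within oitv (- M)%E N, continuous a})
    (b_cont : {within oitv (- M)%E N, continuous b})
    (a_gt0 : forall x, oitv (- M)%E N x -> 0 < a x)
    (x0 : R) (x0_in : oitv (- M)%E N x0) :
  ((nu M N a b x0 (oitv (- M) N) < +oo)%E ->
     ((kappaDD M N a b x0)^-1 <= lambdaDD M N a b x0)%E) /\
  ((mu M N a b x0 (oitv (- M) N) < +oo)%E ->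
     ((kappaNN M N a b x0)^-1 <= lambdaNN M N a b x0)%E).
Proof.
set I := oitv (- M)%E N in a_cont b_cont a_gt0 x0_in *.
have oI : open I by exact: open_oitv.
have iI : is_interval I by exact: is_interval_oitv.
have on (f : R -> R) : {within I, continuous f} -> continuous_on I f.
  by rewrite continuous_open_subspace// => cf x Ix; apply: cf; rewrite inE.
have ca := on a a_cont; have cb := on b b_cont.
have caV : continuous_on I (fun x => (a x)^-1).
  by move=> x Ix; apply: continuousV; [rewrite gt_eqF// a_gt0|exact: ca].
pose C := Cfun a b x0.
have cC : continuous_on I C.
  apply: (@continuous_on_primitive _ I (fun u => b u / a u) x0) => //.
  exact: continuous_onM.
pose m x : R := expR (C x) / a x; pose n x : R := expR (- C x).
have cexp (h : R -> R) : continuous_on I h -> continuous_on I (fun x => expR (h x)).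
  by move=> ch x Ix; apply: continuous_comp; [exact: ch|exact: continuous_expR].
have cm : continuous_on I m by apply: continuous_onM => //; exact: cexp.
have cn : continuous_on I n by apply: cexp; exact: continuous_onN.
have m0 x : I x -> 0 < m x by move=> Ix; rewrite divr_gt0 ?expR_gt0 ?a_gt0.
have n0 x : I x -> 0 < n x by move=> _; exact: expR_gt0.
have muE : mu M N a b x0 = weighted I m by [].
have nuE : nu M N a b x0 = weighted I n by [].
have DE g : Dform M N a b x0 g =
    (\int[lebesgue_measure]_(x in I) (derive1 g x ^+ 2 / n x)%:E)%E.
  by apply: eq_integral => x _; rewrite /n expRN invrK.
have D0 g : (0 <= Dform M N a b x0 g)%E.
  by apply: integral_ge0 => x _; rewrite lee_fin mulr_ge0 ?sqr_ge0// expR_ge0.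
split=> fin.
- apply: le_ereal_inf_tmp => _ [g /= [acg gN] <-].
  have [acgI _] := acg; have cg := locally_AC_continuous acgI.
  apply: kappa_inv_le => // x y K Ix Iy xy; rewrite muE nuE => maxK.
  have [cf f0] := fxy_continuous_pos cn n0 fin Ix Iy xy.
  have [t [It [hmt hpt] hmK hpK]] := max_sup_II_bounds M_gt0 N_gt0 f0 maxK.
  rewrite DE; apply: (dirichlet_energy_bound cm cn cf m0 n0 f0 It hmt hpt hmK hpK acg).
  exact: L2norm_eq1 gN.
- apply: le_ereal_inf_tmp => _ [g /= [acg gm gN] <-].
  have cg := locally_AC_continuous acg.
  apply: kappa_inv_le => // x y K Ix Iy xy; rewrite muE nuE => maxK.
  have [cf f0] := fxy_continuous_pos cm m0 fin Ix Iy xy.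
  have [t [It [hmt hpt] hmK hpK]] := max_sup_II_bounds M_gt0 N_gt0 f0 maxK.
  rewrite DE; apply: (neumann_energy_bound cn cm cf n0 m0 f0 fin It hmt hpt hmK hpK acg).
  + by rewrite -integral_weighted_signed.
  + exact: L2norm_eq1 gN.
Qed.
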